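(* Let $T$ be a countable Dedekind domain such that $T/J$ is finite for every nonzero proper ideal $J\subset T$, equipped with the discrete $\sigma$-algebra. Let $\mathcal{I}$ be the set of all nonzero ideals $I$ of $T$ such that $T/I$ is an elementary abelian group, and let $\epsilon\in\mathbb{R}_{>0}^{\mathcal{I}}$. Let $P=\{\mathfrak{p}_1,\dots,\mathfrak{p}_k\}$ be a finite set of nonzero prime ideals of $T$ and let $T_{\mathfrak{p}_i}=\varprojlim_m T/\mathfrak{p}_i^m$. Let $u$ be a positive integer and, for each $n$, let $M(n)$ be an $\epsilon$-balanced $n\times(n+u)$ random matrix with entries in $T$. Then \[\lim_{n\to\infty}\mathbb{P}\left(\mathrm{cok}(M(n))\otimes \prod_{i=1}^kT_{\mathfrak{p}_i}\ \text{is finite}\right)=1.\]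
   Context: An abelian group is elementary abelian if it is isomorphic to $(\mathbb{Z}/p\mathbb{Z})^m$ for some prime $p$ and integer $m>0$. If $V$ is an $\mathbb{F}_p$-vector space, a random variable $y$ in $V$ is $\epsilon'$-balanced if $\mathbb{P}(y\in H)\leq 1-\epsilon'$ for every proper affine $\mathbb{F}_p$-subspace $H\subset V$. A random variable $y$ valued in $T$ is $\epsilon$-balanced (with $\epsilon=(\epsilon_I)_{I\in\mathcal{I}}$) if for every $I\in\mathcal{I}$ the image of $y$ in $T/I$ is $\epsilon_I$-balanced. A random matrix with entries in $T$ is $\epsilon$-balanced if its entries are independent and each is $\epsilon$-balanced. $\mathrm{cok}(M)=T^n/M(T^{n+u})$. *)

(* Defs.v *)
From HB Require Import structures.
From mathcomp Require Import all_boot all_order all_algebra.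
From mathcomp Require Import all_classical all_reals all_analysis.
Set Implicit Arguments. Unset Strict Implicit. Unset Printing Implicit Defensive.
Import Order.TTheory GRing.Theory Num.Theory.
Local Open Scope classical_set_scope.
Local Open Scope ring_scope.

Section RingTheory.
Variable T : idomainType.

Definition is_ideal (I : set T) : Prop :=
  [/\ I 0, (forall x y, I x -> I y -> I (x + y)) & (forall a x, I x -> I (a * x))].

Definition nonzero_ideal (I : set T) : Prop := exists x, I x /\ x != 0.

Definition prime_ideal (I : set T) : Prop :=
  [/\ is_ideal I, ~ I 1 & forall a b, I (a * b) -> I a \/ I b].

Definition maximal_ideal (I : set T) : Prop :=
  [/\ is_ideal I, ~ I 1 &
      forall J, is_ideal J -> I `<=` J -> J = I \/ J = setT].

Definition noetherian : Prop :=
  forall I, is_ideal I -> exists s : seq T,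
    (forall a, a \in s -> I a) /\
    forall x, I x -> exists c : 'I_(size s) -> T, x = \sum_(i < size s) c i * s`_i.

(* integrally closed in its fraction field: if a/b (b != 0) is a root of a
   monic polynomial p of degree d, i.e. sum_i p_i a^i b^(d-i) = 0, then b | a *)
Definition integrally_closed : Prop :=
  forall a b : T, b != 0 ->
    (exists p : {poly T}, p \is monic /\
        \sum_(i < size p) p`_i * a ^+ i * b ^+ ((size p).-1 - i) = 0) ->
    exists c, a = c * b.

Definition dedekind : Prop :=
  [/\ noetherian, integrally_closed &
      forall p, prime_ideal p -> nonzero_ideal p -> maximal_ideal p].

Definition countable_ring : Prop := exists f : T -> nat, injective f.

Definition finite_quotient (J : set T) : Prop :=
  exists s : seq T, forall x, exists2 y, y \in s & J (x - y).

Definition finite_residues : Prop :=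
  forall J, is_ideal J -> nonzero_ideal J -> ~ J 1 -> finite_quotient J.

(* I nonzero ideal with T/I isomorphic (as abelian group) to (Z/pZ)^m,
   p prime, m > 0; the isomorphism is given through a surjective additive
   map T -> (Z/pZ)^m with kernel I (first isomorphism theorem). *)
Definition elem_abelian_quotient (I : set T) : Prop :=
  [/\ is_ideal I, nonzero_ideal I &
    exists (p m : nat) (phi : T -> 'rV['Z_p]_m),
      [/\ prime p, (0 < m)%N, {morph phi : x y / x + y},
          (forall v, exists x, phi x = v) & forall x, phi x = 0 <-> I x]].

Definition ideal_mul (I J : set T) : set T :=
  [set x | exists s : seq (T * T),
     (forall q, q \in s -> I q.1 /\ J q.2) /\ x = \sum_(q <- s) q.1 * q.2].

Fixpoint ideal_pow (I : set T) (m : nat) : set T :=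
  if m is m'.+1 then ideal_mul I (ideal_pow I m') else setT.

(* An element of T_p = lim_m T/p^m is represented by a compatible sequence
   (x_m)_m, x_m standing for its class in T/p^m, with x_{m+1} = x_m mod p^m;
   two sequences x, y represent the same element iff x_m - y_m \in p^m for all m. *)
Definition compat (p : set T) (x : nat -> T) : Prop :=
  forall m, ideal_pow p m (x m.+1 - x m).

(* cok(M) (x)_T prod_i T_{p_i}  =  A^n / M(A^l)  with A = prod_i T_{p_i}
   (right exactness of tensor product).  It is finite iff there are finitely
   many elements v_1..v_r of A^n such that every w in A^n is congruent to
   some v_t modulo M(A^l).  Elements of A^n are families indexed by
   i < k (factor) and a < n (coordinate) of compatible sequences. *)
Definition cok_tensor_finite (k : nat) (ps : 'I_k -> set T) (n l : nat)
    (M : 'M[T]_(n, l)) : Prop :=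
  exists (r : nat) (v : 'I_r -> 'I_k -> 'I_n -> nat -> T),
    (forall t i a, compat (ps i) (v t i a)) /\
    forall w : 'I_k -> 'I_n -> nat -> T, (forall i a, compat (ps i) (w i a)) ->
      exists (t : 'I_r) (z : 'I_k -> 'I_l -> nat -> T),
        (forall i b, compat (ps i) (z i b)) /\
        forall i a m, ideal_pow (ps i) m
          (w i a m - v t i a m - \sum_(b < l) M a b * z i b m).

End RingTheory.

Section Prob.
Variables (T : idomainType) (R : realType) (d : measure_display)
  (Omega : measurableType d) (P : probability Omega R).

(* the image of y in T/I is e-balanced: for every proper affine F_p-subspace
   of T/I.  Affine subspaces of the elementary abelian p-group T/I are cosets
   a + G/I of subgroups G/I (subgroups = F_p-subspaces), G an additive
   subgroup with I <= G, proper iff G <> T. *)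
Definition balanced_mod (y : Omega -> T) (I : set T) (e : R) : Prop :=
  forall (G : set T) (a : T),
    (G 0 /\ forall x x', G x -> G x' -> G (x - x')) ->
    I `<=` G -> G <> setT ->
    Order.le (P [set w | G (y w - a)]) ((1 - e)%:E).

Definition balanced_rv (eps : set T -> R) (y : Omega -> T) : Prop :=
  forall I, elem_abelian_quotient I -> balanced_mod y I (eps I).

Definition discrete_rv (y : Omega -> T) : Prop :=
  forall A : set T, measurable [set w | A (y w)].

Definition balanced_matrix (eps : set T -> R) (n l : nat)
    (X : Omega -> 'M[T]_(n, l)) : Prop :=
  [/\ (forall i j, discrete_rv (fun w => X w i j)),
      (forall A : 'I_n -> 'I_l -> set T,
         P [set w | forall i j, A i j (X w i j)] =
         \big[mule/1%E]_(i < n) \big[mule/1%E]_(j < l) P [set w | A i j (X w i j)]) &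
      (forall i j, balanced_rv eps (fun w => X w i j))].

End Prob.

(* Main.v *)
Require Import Defs.
From HB Require Import structures.
From mathcomp Require Import all_boot all_order all_algebra.
From mathcomp Require Import all_classical all_reals all_analysis.
From mathcomp Require Import all_field ring lra.
Set Implicit Arguments. Unset Strict Implicit. Unset Printing Implicit Defensive.
Import Order.TTheory GRing.Theory Num.Theory.
Local Open Scope ring_scope.

(** If the cokernel stays infinite after completing at the primes, then [M] has
    a nonzero left kernel vector over [T].  Fix one prime [p] of the list.  Since
    some fraction [b / a] outside [T] maps [p] into [T], and nonzero ideals are
    not stable under it, the kernel vector can be chosen with a coordinate
    outside [p].  Either few of its coordinates lie outside [p], and its
    reduction is a sparse kernel vector modulo [p], which a union bound excludes;
    or many do, and its reduction modulo [p ^ m] is a vector [f] with many unit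
    coordinates.  For such [f] every entry of [f M] is nearly uniform on
    [T / p ^ m]: convolving with a balanced law contracts the L2 norm of mean
    zero functions.  Hence the expected number of such [f] with [f M = 0] is at
    most about [#|T / p ^ m| ^ - u], which tends to zero with [m] as [u > 0]. *)

(** * Convolution by balanced laws on a finite ring *)

(** Why two regimes: making [#|T / p ^ m| ^- u] small requires a large [m], but the contraction rate
    obtained from [defect_gap] degrades exponentially in [#|C|], and vectors with few units over
    [T / p ^ m] need not equidistribute at all. Those are counted over the field [T / p], where one
    nonzero coordinate already costs a factor [1 - e] per column. The threshold [n %/ h] between
    sparse and dense is fixed by [T / p] alone, so [m] can be chosen afterwards; dense vectors still
    have linearly many units, which beats any fixed rate. One prime is enough because a kernel
    vector over the domain [T] can be made visible at every nonzero prime, whichever completion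
    caused the infinite cokernel. Balancedness speaks only of cosets of subgroups; it enters because
    a mean zero function cannot be nearly invariant under all shifts, so its near periods are caught
    in a proper subgroup. *)

Section Equidistribution.
Variables (R : realFieldType) (C : finComNzRingType).
Implicit Types (mu g : C -> R) (H : {set C}) (f x s : C).

Definition prob_weights mu := (forall c, 0 <= mu c) /\ \sum_c mu c = 1.

Definition add_subgroup H := 0 \in H /\ {in H &, forall x y, x - y \in H}.

Definition balanced e mu := forall H a, add_subgroup H -> H <> [set: C] ->
  \sum_(c | c - a \in H) mu c <= 1 - e.

Definition convolve f mu g x := \sum_d mu d * g (x + f * d).

Definition sqnorm g := \sum_x g x ^+ 2.

(** The squared L2 distance from [g] to its translate, measuring how far [s] is from being a period
    of [g]. *)
Definition defect g s := \sum_x (g (x + s) - g x) ^+ 2.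

Lemma sqnorm_ge0 g : 0 <= sqnorm g.
Proof. by apply: sumr_ge0 => x _; exact: sqr_ge0. Qed.

Lemma sum_convolve f mu g : prob_weights mu ->
  \sum_x convolve f mu g x = \sum_x g x.
Proof.
move=> [_ mu1]; rewrite exchange_big /= -[RHS]mul1r -mu1 mulr_suml.
apply: eq_bigr => d _; rewrite -mulr_sumr; congr (_ * _).
by rewrite [RHS](reindex_inj (addIr (f * d))).
Qed.

(** The variance written with an independent copy: half the mean of [(g c - g d) ^+ 2]. *)
Lemma sqr_mean mu g : prob_weights mu ->
  (\sum_c mu c * g c) ^+ 2 = \sum_c mu c * g c ^+ 2
    - 2^-1 * \sum_c \sum_d mu c * mu d * (g c - g d) ^+ 2.
Proof.
move=> [_ mu1].
have -> : \sum_c \sum_d mu c * mu d * (g c - g d) ^+ 2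
  = (\sum_c mu c * g c ^+ 2) * (\sum_d mu d) + (\sum_c mu c) * (\sum_d mu d * g d ^+ 2)
    - 2 * ((\sum_c mu c * g c) * (\sum_d mu d * g d)).
  rewrite !big_distrlr /= -big_split mulr_sumr -sumrB /=; apply: eq_bigr => c _.
  rewrite -big_split mulr_sumr -sumrB; apply: eq_bigr => d _ /=; ring.
by rewrite mu1; field.
Qed.

Lemma defect_shift g s t : \sum_x (g (x + s) - g (x + t)) ^+ 2 = defect g (s - t).
Proof.
rewrite /defect [RHS](reindex_inj (addIr t)); apply: eq_bigr => x _ /=.
by rewrite -addrA [t + _]addrC subrK.
Qed.

Lemma defect_ge0 g s : 0 <= defect g s.
Proof. by apply: sumr_ge0 => x _; exact: sqr_ge0. Qed.

(** Apply the variance identity at each [x] and sum: the norm lost is half the mean defect at the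
    difference of two independent steps. *)
Lemma sqnorm_convolve f mu g : prob_weights mu ->
  sqnorm (convolve f mu g) = sqnorm g
    - 2^-1 * \sum_c \sum_d mu c * mu d * defect g (f * (c - d)).
Proof.
move=> dmu; have [_ mu1] := dmu.
rewrite /sqnorm (eq_bigr _ (fun x _ => sqr_mean (fun d => g (x + f * d)) dmu)).
rewrite sumrB; congr (_ - _).
  rewrite exchange_big /= -[RHS]mul1r -mu1 mulr_suml.
  apply: eq_bigr => d _; rewrite -mulr_sumr; congr (_ * _).
  by rewrite [RHS](reindex_inj (addIr (f * d))).
rewrite -mulr_sumr exchange_big; congr (_ * _); apply: eq_bigr => c _ /=.
rewrite exchange_big; apply: eq_bigr => d _ /=.
by rewrite -mulr_sumr mulrBr defect_shift.
Qed.

Lemma sqnorm_convolve_le f mu g : prob_weights mu ->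
  sqnorm (convolve f mu g) <= sqnorm g.
Proof.
move=> dmu; rewrite sqnorm_convolve // lerBlDr lerDl mulr_ge0 ?invr_ge0 ?ler0n //.
apply: sumr_ge0 => c _; apply: sumr_ge0 => d _; have [mu0 _] := dmu.
by rewrite !mulr_ge0 ?defect_ge0.
Qed.

Lemma defectB g s t : defect g (s - t) <= 2 * defect g s + 2 * defect g t.
Proof.
rewrite -defect_shift !mulr_sumr -big_split; apply: ler_sum => x _ /=.
by have := sqr_ge0 (g (x + s) - g x + (g (x + t) - g x)); lra.
Qed.

(** After expanding the square, the cross terms sum over [s] to a multiple of the mean of [g], hence
    vanish. *)
Lemma sum_defect g : \sum_x g x = 0 -> \sum_s defect g s = 2 * #|C|%:R * sqnorm g.
Proof.
move=> g0; rewrite exchange_big /=.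
have E x : \sum_s (g (x + s) - g x) ^+ 2 = sqnorm g + #|C|%:R * g x ^+ 2.
  transitivity (\sum_s g (x + s) ^+ 2 + (\sum_(s : C) g x ^+ 2 - 2 * g x * \sum_s g (x + s))).
    by rewrite mulr_sumr -sumrB -big_split; apply: eq_bigr => s _ /=; ring.
  rewrite sumr_const -[g x ^+ 2 *+ _]mulr_natl.
  have -> : \sum_s g (x + s) = 0 by rewrite -[RHS]g0 [RHS](reindex_inj (addrI x)).
  by rewrite mulr0 subr0 /sqnorm [X in _ = X + _](reindex_inj (addrI x)).
rewrite (eq_bigr _ (fun x _ => E x)) big_split sumr_const -mulr_sumr -mulr_natl /=.
by rewrite /sqnorm; ring.
Qed.

(* The sublevel sets [H k] of the defect at heights [4 ^ k] satisfy
   [H k - H k `<=` H k.+1] by the triangle inequality, so they become a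
   subgroup as soon as they stop growing. *)
Lemma defect_gap g : \sum_x g x = 0 -> 0 < sqnorm g ->
  exists H, [/\ add_subgroup H, H <> [set: C] &
    forall s, s \notin H -> sqnorm g / 4 ^+ #|C| <= defect g s].
Proof.
move=> g0 gpos; set eta := _ / _.
have eta0 : 0 < eta by rewrite divr_gt0 // exprn_gt0.
pose H k := [set s | defect g s <= 4 ^+ k * eta].
have H0 k : 0 \in H k.
  rewrite inE /defect big1 => [|x _]; last by rewrite addr0 subrr expr0n.
  by rewrite mulr_ge0 ?exprn_ge0 ?ltW.
have HB k s t : s \in H k -> t \in H k -> s - t \in H k.+1.
  rewrite !inE => hs ht; apply: le_trans (defectB g s t) _.
  by rewrite exprS; lra.
have HS k : H k \subset H k.+1.
  by apply/fintype.subsetP => s Hs; rewrite -[s]subr0; apply: HB.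
(* Otherwise [H 0], ..., [H #|C|] would grow strictly from a nonempty set and outgrow [C]. *)
have [k [kC Ek]] : exists k, (k < #|C|)%N /\ H k.+1 = H k.
  have [/existsP[k /eqP Ek]|] := boolP [exists k : 'I_#|C|, H k.+1 == H k].
    by exists k.
  rewrite negb_exists => /forallP nE.
  suff : (#|C| < #|H #|C|%N|)%N by rewrite ltnNge max_card.
  have : (#|C| <= #|C|)%N by [].
  elim: {1 3 4}#|C| => [|k IH] kC; first by apply/card_gt0P; exists 0.
  apply: leq_ltn_trans (IH (ltnW kC)) _; apply: proper_card.
  by rewrite finset.properEneq HS andbT eq_sym (nE (Ordinal kC)).
exists (H k); split.
- by split=> // s t Hs Ht; rewrite -Ek; exact: HB.
(* If [H k] were everything, each defect would be at most [4 ^+ #|C| * eta = sqnorm g], while their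
   average is [2 * sqnorm g]. *)
- move=> HT; have : \sum_s defect g s <= \sum_(s : C) 4 ^+ #|C| * eta.
    apply: ler_sum => s _; have : s \in H k by rewrite HT inE.
    rewrite inE => /le_trans; apply; rewrite ler_pM2r //.
    by rewrite ler_eXn2l ?ltr1n // ltnW.
  rewrite sum_defect // sumr_const -mulr_natl /eta mulrC [_ ^+ _ * _]mulrC divfK; last first.
    by rewrite expf_neq0 // pnatr_eq0.
  have C0 : 0 < #|C|%:R :> R by rewrite ltr0n; apply/card_gt0P; exists 0.
  have := mulr_gt0 C0 gpos; lra.
- move=> s; rewrite inE -ltNge => /ltW; apply: le_trans.
  by rewrite ler_peMl ?(ltW eta0) // exprn_ege1 // ler1n.
Qed.

(** Let [K] be the preimage under [f] of the subgroup from [defect_gap]; it is proper since [f] acts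
    bijectively. Given one step [d], the other step [c] leaves the coset [d + K] with probability at
    least [e], and then the defect is at least [sqnorm g / 4 ^+ #|C|]. The remaining [2] is the half
    in the variance identity. *)
Lemma sqnorm_convolve_contract e f mu g :
    prob_weights mu -> balanced e mu -> 0 <= e -> injective ( *%R f) ->
    \sum_x g x = 0 ->
  sqnorm (convolve f mu g) <= (1 - e / (2 * 4 ^+ #|C|)) * sqnorm g.
Proof.
move=> dmu bmu e0 inj_f g0; have [mu0 mu1] := dmu.
have := sqnorm_ge0 g; rewrite le_eqVlt => /orP[/eqP g00|gpos].
  by rewrite -g00 mulr0 g00; exact: sqnorm_convolve_le.
have [H [[H0 HB] HT gap]] := defect_gap g0 gpos.
have [f' _ fK'] := injF_bij inj_f.
pose K := [set c | f * c \in H].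
have sK : add_subgroup K.
  by split=> [|x y]; rewrite !inE ?mulr0 // mulrBr; exact: HB.
have KT : K <> [set: C].
  move=> KT; apply: HT; apply/setP => x; rewrite inE -(fK' x).
  by have : f' x \in K; [rewrite KT inE|rewrite inE].
rewrite sqnorm_convolve // mulrBl mul1r lerB //.
have -> : e / (2 * 4 ^+ #|C|) * sqnorm g = 2^-1 * (e * (sqnorm g / 4 ^+ #|C|)).
  by rewrite invfM; ring.
rewrite ler_pM2l ?invr_gt0 ?ltr0n // exchange_big /=.
set eta := _ / _ in gap *; have eta0 : 0 <= eta.
  by rewrite mulr_ge0 ?invr_ge0 ?exprn_ge0 ?ltW.
rewrite -[X in X <= _]mul1r -mu1 mulr_suml; apply: ler_sum => d _.
have -> : \sum_c mu c * mu d * defect g (f * (c - d)) =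
    mu d * \sum_c mu c * defect g (f * (c - d)).
  by rewrite mulr_sumr; apply: eq_bigr => c _; ring.
apply: ler_wpM2l => //; rewrite (bigID (fun c => c - d \in K)) /=.
rewrite -[X in X <= _]add0r lerD ?sumr_ge0 // => [c _|].
  by rewrite mulr_ge0 ?defect_ge0.
apply: (@le_trans _ _ (\sum_(c | c - d \notin K) mu c * eta)).
  rewrite -mulr_suml ler_wpM2r //.
  have := bmu K d sK KT; have := mu1; rewrite (bigID (fun c => c - d \in K)) /=; lra.
by apply: ler_sum => c cK; rewrite ler_wpM2l // gap //; move: cK; rewrite inE.
Qed.

Definition walk n (f : 'I_n -> C) (mu : 'I_n -> C -> R) g x :=
  \sum_(c : {ffun 'I_n -> C}) (\prod_i mu i (c i)) * g (x + \sum_i f i * c i).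

Lemma big_ffun_recl (V : nmodType) n (F : {ffun 'I_n.+1 -> C} -> V) :
  \sum_c F c = \sum_d \sum_(c : {ffun 'I_n -> C})
    F [ffun i => if unlift ord0 i is Some j then c j else d].
Proof.
rewrite pair_big /=.
pose h (p : C * {ffun 'I_n -> C}) : {ffun 'I_n.+1 -> C} :=
  [ffun i => if unlift ord0 i is Some j then p.2 j else p.1].
rewrite (reindex h) //=; exists (fun c => (c ord0, [ffun j => c (lift ord0 j)])).
  move=> [d c] _; rewrite /h /= ffunE unlift_none; congr (_, _).
  by apply/ffunP => j; rewrite !ffunE liftK.
by move=> c _; apply/ffunP => i; rewrite ffunE; case: unliftP => [j|] ->; rewrite ?ffunE.
Qed.

Lemma walk0 (f : 'I_0 -> C) (mu : 'I_0 -> C -> R) g : walk f mu g =1 g.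
Proof.
move=> x; rewrite /walk (bigD1 [ffun=> 0]) //= [X in _ + X]big1 => [|c].
  by rewrite !big_ord0 mul1r !addr0.
by case/eqP; apply/ffunP => -[].
Qed.

Lemma walkS n (f : 'I_n.+1 -> C) (mu : 'I_n.+1 -> C -> R) g :
  walk f mu g =1 convolve (f ord0) (mu ord0)
    (walk (fun i => f (lift ord0 i)) (fun i => mu (lift ord0 i)) g).
Proof.
move=> x; rewrite /walk big_ffun_recl; apply: eq_bigr => d _.
rewrite mulr_sumr; apply: eq_bigr => c _.
rewrite !big_ord_recl !ffunE unlift_none -!mulrA -!addrA; congr (_ * (_ * g (_ + (_ + _)))).
  by apply: eq_bigr => i _; rewrite ffunE liftK.
by apply: eq_bigr => i _; rewrite ffunE liftK.
Qed.

Lemma eq_sqnorm g g' : g =1 g' -> sqnorm g = sqnorm g'.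
Proof. by move=> E; apply: eq_bigr => x _; rewrite E. Qed.

(** Steps in [U] contract, the others do not expand. Mean zero is carried along because each
    contraction needs it for the function already averaged. *)
Lemma sqnorm_walk e n (f : 'I_n -> C) (mu : 'I_n -> C -> R) g (U : pred 'I_n) :
    0 <= e <= 1 -> (forall i, prob_weights (mu i)) -> (forall i, balanced e (mu i)) ->
    (forall i, U i -> injective ( *%R (f i))) -> \sum_x g x = 0 ->
  \sum_x walk f mu g x = 0 /\
  sqnorm (walk f mu g) <= (1 - e / (2 * 4 ^+ #|C|)) ^+ #|U| * sqnorm g.
Proof.
move=> /andP[e0 e1] dmu bmu injf g0; set r := 1 - _.
have r0 : 0 <= r.
  have four1 : 1 <= 4 ^+ #|C| :> R by rewrite exprn_ege1 // ler1n.
  by rewrite /r subr_ge0 ler_pdivrMr; lra.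
have -> : r ^+ #|U| = \prod_(i : 'I_n) (if U i then r else 1).
  by rewrite -big_mkcond prodr_const.
elim: n f mu U dmu bmu injf => [|n IH] f mu U dmu bmu injf.
  by rewrite (eq_bigr _ (fun x _ => walk0 f mu g x)) (eq_sqnorm (walk0 f mu g)) big_ord0 mul1r.
have [||| s0 le_g] := IH (fun i => f (lift ord0 i)) (fun i => mu (lift ord0 i))
  (fun i => U (lift ord0 i)) => [i|i|i /injf|] //.
split; first by rewrite (eq_bigr _ (fun x _ => walkS f mu g x)) sum_convolve.
rewrite (eq_sqnorm (walkS f mu g)) big_ord_recl -mulrA.
case: ifP => Ui; last by rewrite mul1r; apply: le_trans le_g; exact: sqnorm_convolve_le.
apply: (le_trans (sqnorm_convolve_contract (dmu _) (bmu _) e0 (injf _ Ui) s0)).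
by rewrite -/r ler_wpM2l.
Qed.

(** For [g] the point mass at [0] minus the uniform law, the deviation from uniform is the value of
    the walk at [0], bounded by its L2 norm. The constant [8] avoids a square root and leaves an
    exponent [2 * #|U|], whose two halves are spent separately in [expr1D_geometric_le2]. *)
Lemma walk_return_bound e n (f : 'I_n -> C) (mu : 'I_n -> C -> R) (U : pred 'I_n) :
    0 <= e <= 1 -> (forall i, prob_weights (mu i)) -> (forall i, balanced e (mu i)) ->
    (forall i, U i -> injective ( *%R (f i))) ->
  \sum_(c : {ffun 'I_n -> C} | \sum_i f i * c i == 0) \prod_i mu i (c i)
    <= #|C|%:R^-1 + (1 - e / (8 * 4 ^+ #|C|)) ^+ (2 * #|U|).
Proof.
move=> e01 dmu bmu injf; have /andP[e0 e1] := e01.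
pose g x : R := (x == 0)%:R - #|C|%:R^-1.
have C0 : #|C|%:R != 0 :> R.
  by rewrite pnatr_eq0 -lt0n; apply/card_gt0P; exists 0.
have sdelta : \sum_x ((x : C) == 0)%:R = 1 :> R.
  by rewrite (bigD1 0) //= eqxx big1 ?addr0 // => x /negPf ->.
have g0 : \sum_x g x = 0.
  by rewrite sumrB sdelta sumr_const -[_^-1 *+ _]mulr_natl divff // subrr.
have gle : sqnorm g <= 1.
  have -> : sqnorm g = \sum_(x : C) ((x == 0)%:R * (1 - 2 * #|C|%:R^-1) + #|C|%:R^-1 ^+ 2).
    by apply: eq_bigr => x _; rewrite /g; case: eqP => _ /=; ring.
  rewrite big_split -mulr_suml sdelta sumr_const -[_ ^+ 2 *+ _]mulr_natl expr2 mulrA divff // /=.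
  have : 0 <= #|C|%:R^-1 :> R by rewrite invr_ge0 ler0n.
  lra.
have -> : \sum_(c : {ffun 'I_n -> C} | \sum_i f i * c i == 0) \prod_i mu i (c i)
    = walk f mu g 0 + #|C|%:R^-1.
  have -> : walk f mu g 0 = \sum_(c : {ffun 'I_n -> C})
      ((\prod_i mu i (c i)) * (\sum_i f i * c i == 0)%:R - (\prod_i mu i (c i)) * #|C|%:R^-1).
    by apply: eq_bigr => c _; rewrite /g add0r mulrBr.
  have sprod : \sum_(c : {ffun 'I_n -> C}) \prod_i mu i (c i) = 1.
    by rewrite -bigA_distr_bigA big1 // => i _; case: (dmu i).
  rewrite sumrB -mulr_suml sprod mul1r subrK big_mkcond; apply: eq_bigr => c _.
  by case: eqP => _; rewrite ?mulr1 ?mulr0.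
rewrite addrC lerD2l.
have [_ wle] := sqnorm_walk e01 dmu bmu injf g0.
set t := 1 - e / (8 * _).
have four1 : 1 <= 4 ^+ #|C| :> R by rewrite exprn_ege1 // ler1n.
have e4 : 0 <= e / (8 * 4 ^+ #|C|) <= 1.
  by rewrite divr_ge0 ?mulr_ge0 ?exprn_ge0 //= ler_pdivrMr; lra.
have t0 : 0 <= t by rewrite /t; lra.
(* With [z = e / (8 * 4 ^+ #|C|)] this reads [1 - 4 z <= (1 - z) ^ 4], proved by using
   [1 - 2 z <= (1 - z) ^ 2] twice. *)
have le_t : 1 - e / (2 * 4 ^+ #|C|) <= (t ^+ 2) ^+ 2.
  have -> : e / (2 * 4 ^+ #|C|) = 4 * (e / (8 * 4 ^+ #|C|)) by field; lra.
  rewrite /t; move: (e / _) e4 => z /andP[z0 z1].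
  have h1 : 1 - 2 * z <= (1 - z) ^+ 2 by have := sqr_ge0 z; lra.
  have [z2|z2] := lerP (1 - 2 * z) 0.
    by have := sqr_ge0 ((1 - z) ^+ 2); lra.
  apply: (@le_trans _ _ ((1 - 2 * z) ^+ 2)); first by have := sqr_ge0 z; lra.
  by rewrite lerXn2r // nnegrE ?sqr_ge0 // ltW.
have r0 : 0 <= 1 - e / (2 * 4 ^+ #|C|).
  by rewrite subr_ge0 ler_pdivrMr; lra.
have : walk f mu g 0 ^+ 2 <= (t ^+ (2 * #|U|)) ^+ 2.
  apply: (@le_trans _ _ (sqnorm (walk f mu g))).
    by rewrite /sqnorm (bigD1 0) //= lerDl sumr_ge0 // => x _; exact: sqr_ge0.
  apply: le_trans wle _; rewrite -[X in _ <= X]mulr1.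
  apply: ler_pM; rewrite ?sqnorm_ge0 ?exprn_ge0 //.
  by rewrite -exprM mulnAC !exprM lerXn2r // nnegrE !exprn_ge0.
move=> H; apply: le_trans (ler_norm _) _.
by rewrite -ler_sqr ?nnegrE ?normr_ge0 ?exprn_ge0 // real_normK ?num_real.
Qed.

(** Condition on all coordinates except the last one with [f i != 0]: a single value of that
    coordinate remains allowed, and a point is a coset of the proper subgroup [0]. *)
Lemma walk_atom_bound e n (f : 'I_n -> C) (mu : 'I_n -> C -> R) :
    0 <= e -> (forall i, prob_weights (mu i)) -> (forall i, balanced e (mu i)) ->
    (forall i, f i != 0 -> injective ( *%R (f i))) -> (exists i, f i != 0) ->
  \sum_(c : {ffun 'I_n -> C} | \sum_i f i * c i == 0) \prod_i mu i (c i) <= 1 - e.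
Proof.
move=> e0 dmu bmu injf fN0; pose g x : R := (x == 0)%:R.
have -> : \sum_(c : {ffun 'I_n -> C} | \sum_i f i * c i == 0) \prod_i mu i (c i)
    = walk f mu g 0.
  rewrite big_mkcond; apply: eq_bigr => c _.
  by rewrite add0r /g; case: eqP => _; rewrite ?mulr1 ?mulr0.
(* The induction needs an arbitrary starting point, and the case [f = 0] for the tail beyond the
   last nonzero coordinate. *)
suff [] : (forall x, (exists i, f i != 0) -> walk f mu g x <= 1 - e) /\
    ((forall i, f i = 0) -> walk f mu g =1 g) by move=> H _; exact: H.
elim: n f mu dmu bmu injf {fN0} => [|n IH] f mu dmu bmu injf.
  by split=> [x [[]]|_] //; exact: walk0.
set f' := (fun i => f (lift ord0 i)); set mu' := (fun i => mu (lift ord0 i)).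
have [IH1 IH2] := IH f' mu' (fun=> dmu _) (fun=> bmu _) (fun=> injf _).
have [mu0 mu1] := dmu ord0.
have conv0 h x : convolve 0 (mu ord0) h x = h x.
  rewrite /convolve (eq_bigr (fun d => mu ord0 d * h x)); last by move=> d _; rewrite mul0r addr0.
  by rewrite -mulr_suml mu1 mul1r.
split=> [x fN0|f0]; last first.
  by move=> x; rewrite walkS f0 conv0 IH2 // => i; exact: f0.
rewrite walkS -/f' -/mu'.
have [/existsP f'N0|] := boolP [exists i, f' i != 0].
  rewrite -[X in _ <= X]mul1r -[X in X * (1 - e)]mu1 mulr_suml; apply: ler_sum => d _.
  by apply: ler_wpM2l => //; exact: IH1.
rewrite negb_exists => /forallP f'0.
have {}f'0 i : f' i = 0 by apply/eqP; have := f'0 i; rewrite negbK.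
have f00 : f ord0 != 0.
  case: fN0 => i; case: (unliftP ord0 i) => [j|] -> //.
  by rewrite -/(f' j) f'0 eqxx.
have [h _ hK] := injF_bij (injf _ f00).
have s0 : add_subgroup [set 0].
  by split=> [|y z]; rewrite !inE // => /eqP -> /eqP ->; rewrite subr0.
have nT : [set 0] <> [set: C] by move/setP/(_ 1); rewrite !inE oner_eq0.
apply: le_trans (bmu ord0 [set 0] (h (- x)) s0 nT).
rewrite [X in _ <= X]big_mkcond; apply: ler_sum => d _.
rewrite IH2 // /g inE subr_eq0.
have -> : (x + f ord0 * d == 0) = (d == h (- x)).
  by rewrite addrC addr_eq0 -{1}(hK (- x)) (inj_eq (injf _ f00)).
by case: eqP => _; rewrite ?mulr1 ?mulr0.
Qed.

End Equidistribution.

Local Open Scope classical_set_scope.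

(** * Ideals of Dedekind domains *)

Section Ideals.
Variable T : idomainType.
Implicit Types (I J : set T) (a b x y : T).

Lemma ideal0 I : is_ideal I -> I 0. Proof. by case. Qed.

Lemma idealD I x y : is_ideal I -> I x -> I y -> I (x + y).
Proof. by case=> _ h _; exact: h. Qed.

Lemma idealM I a x : is_ideal I -> I x -> I (a * x).
Proof. by case=> _ _ h; exact: h. Qed.

Lemma ideal_mulr I a x : is_ideal I -> I x -> I (x * a).
Proof. by rewrite mulrC; exact: idealM. Qed.

Lemma idealN I x : is_ideal I -> I x -> I (- x).
Proof. by move=> iI Ix; rewrite -mulN1r; exact: idealM. Qed.

Lemma idealB I x y : is_ideal I -> I x -> I y -> I (x - y).
Proof. by move=> iI Ix Iy; apply: idealD => //; exact: idealN. Qed.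

Lemma ideal_sum I (K : Type) (s : seq K) (F : K -> T) :
  is_ideal I -> (forall k, I (F k)) -> I (\sum_(k <- s) F k).
Proof.
move=> iI IF; elim/big_ind: _ => //; first exact: ideal0.
by move=> x y; exact: idealD.
Qed.

Lemma ideal_mulP I J x y : I x -> J y -> ideal_mul I J (x * y).
Proof.
move=> Ix Jy; exists [:: (x, y)]; split; last by rewrite big_seq1.
by move=> q; rewrite inE => /eqP ->.
Qed.

Lemma ideal_mul_ideal I J : is_ideal I -> is_ideal (ideal_mul I J).
Proof.
move=> iI; split.
- by exists [::]; split=> //; rewrite big_nil.
- move=> x y [s [Hs ->]] [t [Ht ->]]; exists (s ++ t); rewrite big_cat; split=> //.
  by move=> q; rewrite mem_cat => /orP[/Hs|/Ht].
- move=> a x [s [Hs ->]]; exists [seq (a * q.1, q.2) | q <- s]; split.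
    by move=> _ /mapP[q /Hs [q1 q2] ->] /=; split=> //; exact: idealM.
  by rewrite big_map big_distrr; apply: eq_bigr => q _ /=; rewrite mulrA.
Qed.

Lemma ideal_mul_sub I J K : is_ideal K ->
  (forall x y, I x -> J y -> K (x * y)) -> ideal_mul I J `<=` K.
Proof.
move=> iK IJK _ [s [Hs ->]]; rewrite big_seq; elim/big_ind: _.
- exact: ideal0.
- by move=> x y; exact: idealD.
- by move=> q /Hs[]; exact: IJK.
Qed.

Lemma ideal_pow_ideal I m : is_ideal I -> is_ideal (ideal_pow I m).
Proof. by case: m => [|m] iI //=; exact: ideal_mul_ideal. Qed.

Lemma ideal_powS_sub I m : is_ideal I -> ideal_pow I m.+1 `<=` ideal_pow I m.
Proof.
move=> iI; apply: ideal_mul_sub; first exact: ideal_pow_ideal.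
by move=> x y _; apply: idealM; exact: ideal_pow_ideal.
Qed.

Lemma ideal_pow_sub I m n : is_ideal I -> (m <= n)%N -> ideal_pow I n `<=` ideal_pow I m.
Proof.
move=> iI /subnKC <-; elim: (n - m)%N => [|k IH]; first by rewrite addn0.
by rewrite addnS; apply: subset_trans IH; exact: ideal_powS_sub.
Qed.

Lemma ideal_pow1 I : is_ideal I -> ideal_pow I 1 = I.
Proof.
move=> iI; apply/seteqP; split.
  by apply: ideal_mul_sub => // x y Ix _; exact: ideal_mulr.
by move=> x Ix; rewrite -[x]mulr1; exact: ideal_mulP.
Qed.

Lemma ideal_pow_expr I m x : I x -> ideal_pow I m (x ^+ m).
Proof.
by move=> Ix; elim: m => [|m IH] //; rewrite exprS; exact: ideal_mulP.
Qed.

Lemma prime_expr I x m : prime_ideal I -> I (x ^+ m) -> I x.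
Proof.
case=> iI I1 pI; elim: m => [|m IH]; first by rewrite expr0 => /I1.
by rewrite exprS => /pI[|/IH].
Qed.

(** Maximality inverts [x] modulo [I]; a product of two elements [1 - x * y] and [1 - x * z] again
    has the form [1 - x * w], which raises the power. *)
Lemma unit_mod_ideal_pow I x m : maximal_ideal I -> ~ I x ->
  exists y, ideal_pow I m (1 - x * y).
Proof.
move=> [iI I1 mI] Ix.
have [y Iy] : exists y, I (1 - x * y).
  pose J := [set z | exists y, I (z - x * y)].
  have iJ : is_ideal J.
    split.
    - by exists 0; rewrite mulr0 subrr; exact: ideal0.
    - move=> z z' [y Iy] [y' Iy']; exists (y + y').
      by rewrite mulrDr opprD addrACA; exact: idealD.
    - move=> c z [y Iy]; exists (c * y).
      by rewrite mulrCA -mulrBr; exact: idealM.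
  have IJ : I `<=` J by move=> z Iz; exists 0; rewrite mulr0 subr0.
  have [E|JT] := mI J iJ IJ; last by have : J 1 by rewrite JT.
  case: Ix; rewrite -E; exists 1; rewrite mulr1 subrr; exact: ideal0.
elim: m => [|m [z Iz]]; first by exists 0.
exists (y + z - x * (y * z)).
have -> : 1 - x * (y + z - x * (y * z)) = (1 - x * y) * (1 - x * z) by ring.
exact: ideal_mulP.
Qed.

Lemma noetherian_maximal (S : set (set T)) : noetherian T ->
    (forall I, S I -> is_ideal I) -> S !=set0 ->
  exists2 I, S I & forall J, S J -> I `<=` J -> J = I.
Proof.
move=> nT Sid [I0 SI0]; apply: contrapT => nomax.
have next I : exists J, S I -> [/\ S J, I `<=` J & J <> I].
  case: (pselect (S I)) => [SI|nSI]; last by exists I.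
  apply: contrapT => /forallNP H; apply: nomax; exists I => // J SJ IJ.
  by apply: contrapT => JI; apply: (H J).
have [nx nxP] := choice next.
pose c n := iter n nx I0.
have Sc n : S (c n) by elim: n => //= n /nxP[].
have cS n : c n `<=` c n.+1 by case: (nxP _ (Sc n)).
have cmono m n : (m <= n)%N -> c m `<=` c n.
  move/subnKC <-; elim: (n - m)%N => [|k IH]; first by rewrite addn0.
  by rewrite addnS; apply: subset_trans IH _.
pose U := [set x | exists n, c n x].
have iU : is_ideal U.
  split.
  - by exists 0%N; exact: ideal0 (Sid _ (Sc _)).
  - move=> x y [m mx] [n ny]; exists (maxn m n).
    by apply: idealD (Sid _ (Sc _)) _ _; [move: mx|move: ny];
      apply: cmono; rewrite ?leq_maxl ?leq_maxr.
  - by move=> a x [m mx]; exists m; exact: idealM (Sid _ (Sc _)) mx.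
have [s [sU sgen]] := nT U iU.
have [N sN] : exists N, forall a, a \in s -> c N a.
  elim: s sU {sgen} => [|a s IH] sU; first by exists 0%N.
  have [|N1 H1] := IH; first by move=> z zs; apply: sU; rewrite inE zs orbT.
  have [N2 H2] := sU a (mem_head _ _); exists (maxn N1 N2) => z.
  rewrite inE => /orP[/eqP->|/H1]; first exact: cmono (leq_maxr _ _) _ H2.
  exact: cmono (leq_maxl _ _) _.
have [_ _] := nxP _ (Sc N); apply.
apply/seteqP; split; last exact: cS.
move=> x cx; have [e ->] := sgen x (ex_intro _ N.+1 cx).
apply: ideal_sum => [|i]; first exact: Sid.
by apply: idealM; [exact: Sid|apply: sN; rewrite mem_nth].
Qed.

(* Cayley--Hamilton: [b / a] maps a finitely generated module into itself, so
   it is integral over [T]. *)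
Lemma dvd_of_stable_ideal I a b : noetherian T -> integrally_closed T ->
    is_ideal I -> nonzero_ideal I -> a != 0 ->
    (forall x, I x -> exists2 y, I y & b * x = a * y) ->
  exists c, b = c * a.
Proof.
move=> nT icT iI [x0 [Ix0 x0N0]] a0 stab.
have [s [sI sgen]] := nT I iI.
have /choice[C CP] : forall i : 'I_(size s), exists c : 'I_(size s) -> T,
    b * s`_i = a * \sum_j c j * s`_j.
  move=> i; have [|y Iy ->] := stab s`_i; first by apply: sI; rewrite mem_nth.
  by have [c ->] := sgen y Iy; exists c.
have aux (K : fieldType) (X Y Z B : K) : Y != 0 -> Z * B * X = X * Y * (Z * (B / Y)).
  by move=> Y0; field.
apply: icT => //; pose A := \matrix_(j, i) C i j; exists (char_poly A).
split; first exact: char_poly_monic.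
pose F := {fraction T}; pose f : {rmorphism T -> F} := @tofrac T.
have inj_f : injective f by move=> x y /eqP; rewrite tofrac_eq => /eqP.
have fa0 : f a != 0 by rewrite tofrac_eq0.
(* The eigenvector is the row of generators, nonzero because they generate [x0]. *)
have : eigenvalue (map_mx f A) (f b / f a).
  apply/eigenvalueP; exists (\row_i f s`_i).
    apply/rowP => i; rewrite !mxE; apply: (mulfI fa0).
    rewrite [RHS]mulrA [_ * (f b / _)]mulrC divfK // -rmorphM CP rmorphM; congr (_ * _).
    rewrite rmorph_sum; apply: eq_bigr => j _.
    by rewrite !mxE mulrC -rmorphM.
  apply: contraNneq x0N0 => /rowP s0; have [c ->] := sgen x0 Ix0.
  rewrite big1 // => i _; have := s0 i; rewrite !mxE => /eqP.
  by rewrite tofrac_eq0 => /eqP ->; rewrite mulr0.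
rewrite eigenvalue_root_char -map_char_poly => /rootP.
rewrite horner_coef size_map_inj_poly ?rmorph0 // => fsum.
apply: inj_f; rewrite rmorph0 -(mulr0 (f a ^+ (size (char_poly A)).-1)) -fsum.
rewrite rmorph_sum mulr_sumr; apply: eq_bigr => i _.
have le_i : (i <= (size (char_poly A)).-1)%N by rewrite -ltnS prednK ?(leq_ltn_trans _ (ltn_ord i)).
rewrite coef_map !rmorphM !rmorphXn -[in RHS](subnK le_i) exprD expr_div_n.
exact/aux/expf_neq0.
Qed.

(** [colon b] is the annihilator of [b] in [T / (a)]. Among the annihilators contained in [p], a
    maximal one is prime; it contains [a], so it is a maximal ideal and equals [p]. *)
Lemma prime_is_colon p : dedekind T -> prime_ideal p -> nonzero_ideal p ->
  exists a b, [/\ a != 0, (forall x, p x -> exists y, b * x = a * y) &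
                  ~ exists c, b = c * a].
Proof.
move=> [nT icT maxT] pp [a [pa a0]]; have [ip p1 primep] := pp.
pose colon b := [set t | exists y, t * b = y * a].
have icolon b : is_ideal (colon b).
  split.
  - by exists 0; rewrite !mul0r.
  - by move=> x y [z xz] [z' yz]; exists (z + z'); rewrite !mulrDl xz yz.
  - by move=> c x [z xz]; exists (c * z); rewrite -!mulrA xz.
pose S := [set I | I `<=` p /\ exists b, I = colon b].
have [||I] := @noetherian_maximal S nT.
- by move=> _ [_ [b ->]].
- exists (colon 1); split; last by exists 1.
  by move=> t [y]; rewrite mulr1 => ->; exact: idealM.
move=> [Qp [b Eb]] Qmax; rewrite {}Eb in Qp Qmax.
(* Multiplying [b] by an element outside [p] keeps the annihilator inside [p], so by maximality it
   cannot grow. *)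
have absorb r t : ~ p r -> colon b (r * t) -> colon b t.
  move=> pr brt; have Qr : colon (b * r) = colon b.
    apply: Qmax.
      split; last by exists (b * r).
      move=> z [y zy]; have /Qp/primep[] // : colon b (z * r).
      by exists y; rewrite -zy; ring.
    by move=> z [y zy]; exists (r * y); rewrite mulrA zy; ring.
  by rewrite -Qr; case: brt => y rty; exists y; rewrite -rty; ring.
have Q1 : ~ colon b 1 by move/Qp.
have primeQ : prime_ideal (colon b).
  split=> // s t Qst; case: (pselect (colon b t)) => [|Qt]; [by right|left].
  have [r [y rbs] pr] : exists2 r, colon (b * s) r & ~ p r.
    apply: contrapT => H; apply: Qt; rewrite -(Qmax (colon (b * s))) //.
    - by case: Qst => y sty; exists y; rewrite -sty; ring.
    - split; last by exists (b * s).
      by move=> z bsz; apply: contrapT => pz; apply: H; exists z.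
    - by move=> z [y zy]; exists (s * y); rewrite mulrA zy; ring.
  apply: (absorb r) => //.
  by exists y; rewrite -rbs; ring.
have nzQ : nonzero_ideal (colon b) by exists a; split=> //; exists b; rewrite mulrC.
have [_ _ maxQ] := maxT _ primeQ nzQ.
have [pQ|pT] := maxQ _ ip Qp; last by case: p1; rewrite pT.
exists a, b; split=> // [x|[c bc]].
  by rewrite pQ => -[y xb]; exists y; rewrite mulrC xb mulrC.
by apply: Q1; exists c; rewrite mul1r.
Qed.

(** As [p] may not be principal, one cannot divide by a uniformizer. If all kernel vectors had all
    coordinates in [p], the ideal of their [i]-th coordinates would be stable under [b / a]. *)
Lemma primitive_kernel_vector p n l (A : 'M[T]_(n, l)) (x : 'rV[T]_n) :
    dedekind T -> prime_ideal p -> nonzero_ideal p ->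
    x != 0 -> x *m A = 0 ->
  exists2 y : 'rV[T]_n, y *m A = 0 & exists i, ~ p (y 0 i).
Proof.
move=> dT pp nzp x0 xA; apply: contrapT => H.
have allp (y : 'rV_n) : y *m A = 0 -> forall i, p (y 0 i).
  move=> yA i; apply: contrapT => pyi; apply: H; exists y => //; by exists i.
have [a [b [a0 bp]]] := prime_is_colon dT pp nzp; apply.
have /existsP[i xi0] : [exists i, x 0 i != 0].
  rewrite -negb_forall; apply: contra x0 => /forallP x0; apply/eqP/rowP => i.
  by rewrite mxE; apply/eqP.
have [nT icT _] := dT.
apply: (@dvd_of_stable_ideal [set z | exists2 y : 'rV_n, y *m A = 0 & z = y 0 i] a b) => //.
- split.
  + by exists 0; rewrite ?mul0mx ?mxE.
  + by move=> _ _ [y yA ->] [z zA ->]; exists (y + z); rewrite ?mulmxDl ?yA ?zA ?addr0 ?mxE.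
  + by move=> c _ [y yA ->]; exists (c *: y); rewrite -?scalemxAl ?yA ?scaler0 ?mxE.
- by exists (x 0 i); split=> //; exists x.
- move=> _ [y yA ->].
  have /choice[z zP] : forall j, exists z, b * y 0 j = a * z.
    by move=> j; apply: bp; exact: allp.
  have Ez : b *: y = a *: \row_j z j by apply/rowP => j; rewrite !mxE zP.
  exists (z i) => //; exists (\row_j z j); last by rewrite mxE.
  apply/eqP; have : a *: (\row_j z j *m A) == 0.
    by rewrite scalemxAl -Ez -scalemxAl yA scaler0.
  rewrite scalemx_eq0 (negPf a0) //.
Qed.

(** Since [p] is not stable under [b / a], some [t] in [p] is sent to an [r] outside [p]. Then
    [(b / a) ^ i] sends [t ^+ i] to [r ^+ i], outside [p], but sends [p ^ (i + 1)] into [p]. *)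
Lemma prime_power_uniformizer (p : set T) : dedekind T -> prime_ideal p -> nonzero_ideal p ->
  exists2 t, p t & forall i, ~ ideal_pow p i.+1 (t ^+ i).
Proof.
move=> dT pp nzp; have [ip p1 primep] := pp; have [nT icT _] := dT.
have [a [b [a0 bp ndvd]]] := prime_is_colon dT pp nzp.
have [t [pt [r btr npr]]] : exists t, p t /\ exists2 r, b * t = a * r & ~ p r.
  apply: contrapT => H; apply: ndvd; apply: (@dvd_of_stable_ideal p) => //.
  move=> x px; have [y bxy] := bp x px; exists y => //.
  by apply: contrapT => py; apply: H; exists x; split=> //; exists y.
exists t => // i.
have descend x j k : ideal_pow p (j + k) x -> exists2 y, b ^+ j * x = a ^+ j * y & ideal_pow p k y.
  elim: j x => [|j IH] x; first by rewrite add0n !expr0; exists x.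
  rewrite addSn; pose K := [set x | exists2 y, b ^+ j.+1 * x = a ^+ j.+1 * y & ideal_pow p k y].
  have ipk := ideal_pow_ideal k ip.
  suff : ideal_pow p (j + k).+1 `<=` K by apply.
  apply: ideal_mul_sub.
    split.
    - by exists 0; rewrite ?mulr0 //; exact: ideal0.
    - move=> y z [y' yE Iy] [z' zE Iz]; exists (y' + z'); last exact: idealD.
      by rewrite !mulrDr yE zE.
    - move=> c y [y' yE Iy]; exists (c * y'); last exact: idealM.
      by rewrite mulrCA yE mulrCA.
  move=> y z py /IH[z' zE Iz]; have [y' yE] := bp y py.
  exists (y' * z'); last exact: idealM.
  by rewrite !exprS mulrACA yE zE mulrACA.
rewrite -addn1 => /descend[y]; rewrite ideal_pow1 // -exprMn btr exprMn.
move=> /(mulfI (expf_neq0 i a0)) <- /(prime_expr pp); exact: npr.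
Qed.

End Ideals.

(** * Finiteness of the completed cokernel *)

Section Denominators.
Variable T : idomainType.
Local Notation F := {fraction T}.
Local Notation tofrac := (@FracField.tofrac T).

Lemma fraction_eq (x : F) : exists2 d, d != 0 & exists a, tofrac d * x = tofrac a.
Proof.
elim/quotW: x => r; exists (frac r).2; first exact: denom_ratioP.
exists (frac r).1; unlock FracField.tofrac; rewrite -[LHS]FracField.pi_mul.
apply/eqmodP; rewrite /= FracField.equivfE /FracField.mulf.
by rewrite !numden_Ratio ?mulf_neq0 ?oner_eq0 ?denom_ratioP //; apply/eqP; ring.
Qed.

Lemma common_denominator r s (B : 'M[F]_(r, s)) :
  exists2 d, d != 0 & exists A : 'M[T]_(r, s), map_mx tofrac A = tofrac d *: B.
Proof.
have /choice[f fP] : forall ij : 'I_r * 'I_s, exists da : T * T,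
    da.1 != 0 /\ tofrac da.1 * B ij.1 ij.2 = tofrac da.2.
  by move=> ij; have [d d0 [a E]] := fraction_eq (B ij.1 ij.2); exists (d, a).
exists (\prod_ij (f ij).1); first by apply/prodf_neq0 => ij _; case: (fP ij).
exists (\matrix_(i, j) ((\prod_(ij | ij != (i, j)) (f ij).1) * (f (i, j)).2)).
apply/matrixP => i j; rewrite !mxE [in RHS](bigD1 (i, j)) //=.
have [_ E] := fP (i, j); rewrite !rmorphM /= -E /= !mulrA; congr (_ * _); exact: mulrC.
Qed.

(** Clear denominators in a right inverse over the fraction field. The point is that [d] then
    annihilates the cokernel. *)
Lemma right_quasi_inverse n l (A : 'M[T]_(n, l)) :
    (forall x : 'rV_n, x *m A = 0 -> x = 0) ->
  exists2 d, d != 0 & exists N : 'M[T]_(l, n), A *m N = d%:M.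
Proof.
move=> kerA.
have inj_f r s : injective (map_mx tofrac : 'M[T]_(r, s) -> 'M[F]_(r, s)).
  move=> B C /matrixP BC; apply/matrixP => i j; have := BC i j.
  by rewrite !mxE => /eqP; rewrite tofrac_eq => /eqP.
have freeA : row_free (map_mx tofrac A).
  apply: inj_row_free => v vA; have [d d0 [x xE]] := common_denominator v.
  have : map_mx tofrac (x *m A) = 0 by rewrite map_mxM /= xE -scalemxAl vA scaler0.
  rewrite -(map_mx0 tofrac) => /inj_f /kerA x0.
  move/eqP: xE; rewrite x0 map_mx0 eq_sym scalemx_eq0 tofrac_eq0 (negPf d0) /=.
  by move/eqP.
have [B AB] := row_freeP freeA; have [d d0 [N NE]] := common_denominator B.
exists d => //; exists N; apply: inj_f.
by rewrite map_mxM /= NE -scalemxAr AB map_scalar_mx scalemx1.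
Qed.

End Denominators.

Lemma antitone_pigeonhole (X : eqType) (s : seq X) (Q : nat -> X -> Prop) :
    (forall m x, Q m.+1 x -> Q m x) ->
    (forall m, exists2 x, x \in s & Q m x) ->
  exists2 x, x \in s & forall m, Q m x.
Proof.
move=> QS Qs; apply: contrapT => H.
have /choice[g gP] : forall x, exists m, x \in s -> ~ Q m x.
  move=> x; apply: contrapT => /forallNP Hx; apply: H.
  have xs : x \in s by apply: contrapT => xs; apply: (Hx 0%N) => /xs.
  by exists x => // m; apply: contrapT => nQ; apply: (Hx m).
have [x xs Qx] := Qs (\max_(x <- s) g x)%N.
apply: (gP x xs); have := @leq_bigmax_seq _ s xpredT g x xs isT.
move: Qx; move: (\max_(_ <- s) _)%N => m Qx /subnKC Em; rewrite -Em in Qx.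
by elim: (m - g x)%N Qx => [|k IH]; rewrite ?addn0 // addnS => /QS.
Qed.

Section Completion.
Variable T : idomainType.
Implicit Types (p I : set T).

Lemma finite_residues_quotient I : finite_residues T ->
  is_ideal I -> nonzero_ideal I -> finite_quotient I.
Proof.
move=> fT iI nzI; case: (pselect (I 1)) => [I1|]; last exact: fT.
exists [:: 0] => x; exists 0; first exact: mem_head.
by rewrite subr0 -[x]mulr1; exact: idealM.
Qed.

Lemma nonzero_ideal_pow I m : nonzero_ideal I -> nonzero_ideal (ideal_pow I m).
Proof.
by move=> [x [Ix x0]]; exists (x ^+ m); split; [exact: ideal_pow_expr|exact: expf_neq0].
Qed.

Lemma finite_quotient_pow I m : finite_residues T -> is_ideal I -> nonzero_ideal I ->
  finite_quotient (ideal_pow I m).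
Proof.
by move=> fT iI nzI; apply: finite_residues_quotient; rewrite //;
  [exact: ideal_pow_ideal|exact: nonzero_ideal_pow].
Qed.

Lemma finite_quotient_principal d : finite_residues T -> d != 0 ->
  finite_quotient [set x : T | exists z, x = d * z].
Proof.
move=> fT d0; apply: finite_residues_quotient => //; last first.
  by exists d; split=> //; exists 1; rewrite mulr1.
split.
- by exists 0; rewrite mulr0.
- by move=> _ _ [y ->] [z ->]; exists (y + z); rewrite mulrDr.
- by move=> a _ [z ->]; exists (a * z); rewrite mulrCA.
Qed.

(* A Koenig-lemma argument: the quotient by [d] is chosen level by level among
   the finitely many classes that extend to every higher level. *)
Lemma compat_divmod p (d : T) (s : seq T) (w : nat -> T) :
    is_ideal p -> (forall m, finite_quotient (ideal_pow p m)) ->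
    (forall x, exists2 y, y \in s & exists z, x - y = d * z) ->
    compat p w ->
  exists2 y, y \in s &
    exists2 z, compat p z & forall m, ideal_pow p m (w m - y - d * z m).
Proof.
move=> ip fq sP cw.
have ipm m := ideal_pow_ideal m ip.
have down m y z : ideal_pow p m.+1 (w m.+1 - y - d * z) -> ideal_pow p m (w m - y - d * z).
  move=> H; have -> : w m - y - d * z = (w m.+1 - y - d * z) - (w m.+1 - w m) by ring.
  by apply: idealB (cw m) => //; exact: ideal_powS_sub.
have [y ys yP] : exists2 y, y \in s &
    forall m, exists z, ideal_pow p m (w m - y - d * z).
  apply: antitone_pigeonhole => [m y [z /down]|m]; first by exists z.
  have [y ys [z yz]] := sP (w m); exists y => //; exists z.
  by rewrite yz subrr; exact: ideal0.
exists y => //.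
pose good m z := forall m', (m <= m')%N -> exists2 z',
  ideal_pow p m' (w m' - y - d * z') & ideal_pow p m (z' - z).
have step m z : good m z -> exists z1, good m.+1 z1 /\ ideal_pow p m (z1 - z).
  move=> gz; have [r rP] := fq m.+1.
  pose Q j t := exists z', [/\ ideal_pow p (m.+1 + j) (w (m.+1 + j)%N - y - d * z'),
    ideal_pow p m (z' - z) & ideal_pow p m.+1 (z' - t)].
  have [||t tr tP] := @antitone_pigeonhole _ r Q.
  - move=> j t [z' [+ h2 h3]]; rewrite addnS => /down h1; by exists z'.
  - move=> j; have [|z' h1 h2] := gz (m.+1 + j)%N; first by rewrite addSn -addnS leq_addr.
    by have [t tr h3] := rP z'; exists t => //; exists z'.
  exists t; split.
    move=> m' /subnKC <-; have [z' [h1 _ h3]] := tP (m' - m.+1)%N.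
    by exists z'.
  have [z' [_ h2 h3]] := tP 0%N.
  have -> : t - z = (z' - z) - (z' - t) by ring.
  by apply: idealB => //; exact: ideal_powS_sub.
have /choice[nx nxP] : forall mz : nat * T, exists z1, good mz.1 mz.2 ->
    good mz.1.+1 z1 /\ ideal_pow p mz.1 (z1 - mz.2).
  move=> [m z]; case: (pselect (good m z)) => [/step[z1 ?]|n]; first by exists z1.
  by exists 0.
(* Any start would do: [ideal_pow p 0] is the whole ring, so level [0] imposes nothing. *)
pose z := fix z m := if m is m'.+1 then nx (m', z m') else 0.
have gz m : good m (z m).
  elim: m => [m' _|m IH]; first by have [z' ?] := yP m'; exists z'.
  by have [] := nxP (m, z m) IH.
exists z => m; first by have [] := nxP (m, z m) (gz m).
have [z' h1 h2] := gz m m (leqnn m).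
have -> : w m - y - d * z m = (w m - y - d * z') + d * (z' - z m) by ring.
by apply: idealD => //; exact: idealM.
Qed.

(** From [A *m N = d%:M], every multiple [d q] is the image of [N q], so constant sequences of
    representatives modulo [d], chosen coordinate by coordinate, suffice. *)
Lemma cok_tensor_finite_of_trivial_kernel k (ps : 'I_k -> set T) n l (A : 'M[T]_(n, l)) :
    finite_residues T -> (forall i, is_ideal (ps i) /\ nonzero_ideal (ps i)) ->
    (forall x : 'rV_n, x *m A = 0 -> x = 0) ->
  cok_tensor_finite ps A.
Proof.
move=> fT Hps /right_quasi_inverse[d d0 [N AN]].
have [s sP] := finite_quotient_principal fT d0.
pose I := {ffun 'I_k * 'I_n -> 'I_(size s)}.
exists #|{: I}|, (fun t i a _ => s`_((enum_val t : I) (i, a))); split.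
  move=> t i a m; rewrite subrr; apply: ideal0; apply: ideal_pow_ideal.
  by case: (Hps i).
move=> w cw.
have /choice[g gP] : forall ia : 'I_k * 'I_n, exists jz : 'I_(size s) * (nat -> T),
    compat (ps ia.1) jz.2 /\
    forall m, ideal_pow (ps ia.1) m (w ia.1 ia.2 m - s`_jz.1 - d * jz.2 m).
  move=> [i a] /=; have [ip nzp] := Hps i.
  have fq m : finite_quotient (ideal_pow (ps i) m) by exact: finite_quotient_pow.
  have [y ys [z cz zP]] := compat_divmod ip fq sP (cw i a).
  have iy : (index y s < size s)%N by rewrite index_mem.
  by exists (Ordinal iy, z); split=> //= m; rewrite nth_index.
pose z i b m := \sum_a N b a * (g (i, a)).2 m.
exists (enum_rank ([ffun ia => (g ia).1] : I)), z; split.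
  move=> i b m; rewrite -sumrB; apply: ideal_sum.
    by apply: ideal_pow_ideal; case: (Hps i).
  move=> a; rewrite -mulrBr; apply: idealM; first by apply: ideal_pow_ideal; case: (Hps i).
  by have [] := gP (i, a).
move=> i a m; rewrite enum_rankK ffunE; have [_ /(_ m)] := gP (i, a).
suff -> : \sum_b A a b * z i b m = d * (g (i, a)).2 m by [].
transitivity ((A *m N *m \col_a (g (i, a)).2 m) a 0).
  rewrite -mulmxA mxE; apply: eq_bigr => b _; rewrite !mxE; congr (_ * _).
  by apply: eq_bigr => a' _; rewrite !mxE.
by rewrite AN mul_scalar_mx !mxE.
Qed.

End Completion.

(** * Residue rings of prime powers *)

Local Open Scope quotient_scope.

Section FiniteQuotientRing.
Variables (T : comNzRingType) (J : idealr T) (N : nat)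
  (f : {ideal_quot J} -> 'I_N) (g : 'I_N -> {ideal_quot J}).

(** The alias carries the cancellation proof so that the finite structure can be inferred from the
    type. *)
Definition finite_quot of cancel f g : predArgType := {ideal_quot J}.

Variable fK : cancel f g.
HB.instance Definition _ := GRing.ComNzRing.on (finite_quot fK).
HB.instance Definition _ := CanIsCountable (fK : @cancel _ (finite_quot fK) f g).
HB.instance Definition _ :=
  fintype.isFinite.Build (finite_quot fK) (@pcan_enumP (finite_quot fK) _ f _ (can_pcan fK)).

End FiniteQuotientRing.

Section QuotientMaps.
Variable T : idomainType.
Implicit Types (I J p : set T).

Definition quotient_map J (C : finComNzRingType) (pi : {rmorphism T -> C}) : Prop :=
  (forall c, exists x, pi x = c) /\ forall x, pi x = 0 <-> J x.

Lemma quotient_map_exists J : is_ideal J -> ~ J 1 -> finite_quotient J ->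
  exists (C : finComNzRingType) (pi : {rmorphism T -> C}), quotient_map J pi.
Proof.
move=> iJ J1 [s sP].
pose S : {pred T} := [pred x | `[< J x >]].
have SP x : reflect (J x) (x \in S) by exact: asboolP.
have idS : idealr_closed S.
  split; [by apply/SP; exact: ideal0|exact/SP|move=> a x y /SP Jx /SP Jy].
  by apply/SP; apply: (idealD iJ _ Jy); exact: (idealM a iJ Jx).
pose Jr : idealr T := HB.pack (S : T -> bool) (isIdealr.Build T S idS).
pose Q := {ideal_quot Jr}.
have piE x y : (\pi_Q x == \pi_Q y) = `[< J (x - y) >].
  by rewrite -Quotient.idealrBE.
(* The successor makes the index type inhabited, as [inord] requires. *)
pose f (q : Q) : 'I_(size s).+1 := inord (find (fun x => \pi_Q x == q) s).
pose g (i : 'I_(size s).+1) : Q := \pi_Q (nth 0 s i).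
have fK : cancel f g.
  elim/quotW => x; have hs : has (fun y => \pi_Q y == \pi_Q x) s.
    have [y ys Jxy] := sP x; apply/hasP; exists y => //.
    by rewrite eq_sym piE; apply/asboolP.
  rewrite /g /f inordK ?ltnS ?find_size //.
  by apply/eqP; exact: (nth_find 0 hs).
pose h (x : T) : finite_quot fK := \pi_Q x.
have hB : zmod_morphism h by exact: raddfB.
have hM : monoid_morphism h by split; [exact: rmorph1|exact: rmorphM].
pose hz := GRing.isZmodMorphism.Build _ _ h hB.
pose hm := GRing.isMonoidMorphism.Build _ _ h hM.
pose pi : {rmorphism T -> finite_quot fK} := HB.pack h hz hm.
exists (finite_quot fK : finComNzRingType), pi; split.
  by elim/quotW => x; exists x.
move=> x; rewrite -[X in J X]subr0; split.
  by move=> /eqP; rewrite -(rmorph0 pi) piE => /asboolP.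
by move=> Jx; apply/eqP; rewrite -(rmorph0 pi) piE; apply/asboolP.
Qed.

Lemma card_natr_eq0 (C : finComNzRingType) : #|C|%:R = 0 :> C.
Proof.
have : \sum_(x : C) (x + 1) = \sum_(x : C) x by rewrite [RHS](reindex_inj (addIr 1)).
by rewrite big_split sumr_const -[RHS]addr0 => /addrI.
Qed.

(** The cardinal of [T / p] lies in [p]; split off prime factors until one of them does. *)
Lemma residue_characteristic p : prime_ideal p -> finite_quotient p ->
  exists2 l, prime l & p l%:R.
Proof.
move=> [ip p1 pp] fp; have [C [pi [_ kpi]]] := quotient_map_exists ip p1 fp.
have pC : p #|C|%:R by apply/kpi; rewrite rmorph_nat card_natr_eq0.
have : (0 < #|C|)%N by apply/card_gt0P; exists 0.
elim/ltn_ind: #|C| pC => -[//|[//|n]] IH pn _.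
have pr := pdiv_prime (isT : 1 < n.+2)%N; move: pn.
rewrite -(divnK (pdiv_dvd n.+2)) natrM => /pp[pn|]; last by exists (pdiv n.+2).
apply: IH pn _; first by rewrite ltn_Pdiv // prime_gt1.
by rewrite divn_gt0 ?pdiv_gt0 // pdiv_leq.
Qed.

Lemma elem_abelian_of_characteristic I l : is_ideal I -> nonzero_ideal I -> ~ I 1 ->
  finite_quotient I -> prime l -> I l%:R -> elem_abelian_quotient I.
Proof.
move=> iI nzI I1 fI pl Il.
have [C [pi [sur kpi]]] := quotient_map_exists iI I1 fI.
have charC : l \in [pchar C].
  by rewrite inE pl /=; apply/eqP; rewrite -(rmorph_nat pi); apply/kpi.
have [v lin_v [w vK wK]] := pprimeChar_vectAxiom charC.
have vB : {morph v : x y / x + y}.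
  by move=> x y; have := lin_v 1 x y; rewrite !scale1r.
have v0 : v 0 = 0 by apply: (addrI (v 0)); rewrite -vB !addr0.
have n0 : (0 < logn l #|C|)%N.
  rewrite lt0n; apply/eqP => n0; have := card_pprimeChar charC.
  rewrite n0 expn0 => /eqP; apply/negP; rewrite gtn_eqF //.
  by apply/card_gt1P; exists 0, 1; rewrite eq_sym oner_neq0.
split=> //; exists l, (logn l #|C|).
(* Coordinates come over ['F_l], which is ['Z_(pdiv l)]; primality of [l] then turns this into
   ['Z_l]. *)
have : exists phi : T -> 'rV['Z_(pdiv l)]_(logn l #|C|),
    [/\ {morph phi : x y / x + y}, (forall v, exists x, phi x = v) &
        forall x, phi x = 0 <-> I x].
  exists (fun x => v (pi x)); split.
  - by move=> x y; rewrite rmorphD vB.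
  - by move=> u; have [x xE] := sur (w u); exists x; rewrite xE wK.
  - move=> x; rewrite -kpi; split=> [vx|->//].
    by apply: (can_inj vK); rewrite vx v0.
by rewrite pdiv_id // => -[phi [h1 h2 h3]]; exists phi.
Qed.

Lemma quotient_map_unit J (C : finComNzRingType) (pi : {rmorphism T -> C}) x y :
  quotient_map J pi -> J (1 - x * y) -> injective ( *%R (pi x)).
Proof.
move=> [_ kpi] /kpi; rewrite rmorphB rmorph1 rmorphM => /eqP.
rewrite subr_eq0 eq_sym => /eqP xy; apply: (can_inj (g := *%R (pi y))) => z.
by rewrite mulrA [pi y * _]mulrC xy mul1r.

Qed.

(* [I] is the preimage of [l C], [l] the residue characteristic; since [l] is
   nilpotent in [C], adding [l C] to a proper subgroup keeps it proper. *)
Lemma prime_power_quotient p m :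
    dedekind T -> finite_residues T -> prime_ideal p -> nonzero_ideal p ->
  exists (C : finComNzRingType) (pi : {rmorphism T -> C}),
  [/\ quotient_map (ideal_pow p m.+1) pi, (m < #|C|)%N,
      (forall x, ~ p x -> injective ( *%R (pi x))) &
      exists2 I, elem_abelian_quotient I & forall H : {set C},
        add_subgroup H -> H <> [set: C]%SET ->
        exists G : set T, [/\ G 0 /\ (forall x x', G x -> G x' -> G (x - x')),
          I `<=` G, G <> setT & forall x, pi x \in H -> G x]].
Proof.
move=> dT fT pp nzp; have [ip p1 primep] := pp; have [_ _ maxT] := dT.
have sub1 : ideal_pow p m.+1 `<=` p.
  by rewrite -[X in _ `<=` X](ideal_pow1 ip); exact: ideal_pow_sub.
have ipm := ideal_pow_ideal m.+1 ip.
have [C [pi qpi]] := quotient_map_exists ipm (fun h => p1 (sub1 _ h))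
  (finite_quotient_pow m.+1 fT ip nzp).
have [sur kpi] := qpi.
have piE x y : pi x = pi y <-> ideal_pow p m.+1 (x - y).
  rewrite -kpi rmorphB; split=> [->|/eqP]; first by rewrite subrr.
  by rewrite subr_eq0 => /eqP.
exists C, pi; split=> //.
(* The classes of [t ^+ 0], ..., [t ^+ m] are distinct: a coincidence with [i < j] would put
   [t ^+ i] in [p ^ (i + 1)]. *)
- have [t pt tP] := prime_power_uniformizer dT pp nzp.
  have inj : injective (fun i : 'I_m.+1 => pi (t ^+ i)).
    suff lt_inj (i j : 'I_m.+1) : (i < j)%N -> pi (t ^+ i) <> pi (t ^+ j).
      move=> i j Eij; apply/val_inj.
      case: (ltngtP i j) => [/lt_inj /(_ Eij)|/lt_inj|] //.
      by move/(_ (esym Eij)).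
    move=> ij /piE Hij; apply: (tP i).
    rewrite -[t ^+ i](subrK (t ^+ j)); apply: idealD.
    + exact: ideal_pow_ideal.
    + by apply: ideal_pow_sub Hij => //; rewrite ltnS ltnW // ltn_ord.
    + by apply: (ideal_pow_sub ip ij); exact: ideal_pow_expr.
  by have := leq_card _ inj; rewrite card_ord.
- move=> x px; have [y xy] := unit_mod_ideal_pow m.+1 (maxT _ pp nzp) px.
  exact: quotient_map_unit qpi xy.
have [l pl Il] : exists2 l, prime l & p l%:R.
  apply: residue_characteristic => //; exact: finite_residues_quotient.
pose I := [set x | exists t, pi x = l%:R * pi t].
have iI : is_ideal I.
  split.
  - by exists 0; rewrite !rmorph0 mulr0.
  - by move=> x y [t xt] [t' yt]; exists (t + t'); rewrite !rmorphD mulrDr xt yt.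
  - by move=> a x [t xt]; exists (a * t); rewrite !rmorphM xt mulrCA.
have lI : I l%:R by exists 1; rewrite rmorph1 mulr1 rmorph_nat.
have nzI : nonzero_ideal I.
  have [x [Ix x0]] := nonzero_ideal_pow m.+1 nzp; exists x; split=> //.
  by exists 0; rewrite rmorph0 mulr0; apply/kpi.
have I1 : ~ I 1.
  case=> t; rewrite -(rmorph_nat pi) -rmorphM => /piE /sub1 h; apply: p1.
  by rewrite -[1](subrK (l%:R * t)); apply: (idealD ip h); exact: ideal_mulr.
exists I.
  by apply: (elem_abelian_of_characteristic iI nzI I1 _ pl lI); exact: finite_residues_quotient.
move=> H [H0 HB] HT.
have HN x : x \in H -> - x \in H by move=> Hx; rewrite -sub0r; exact: HB.
have HD x y : x \in H -> y \in H -> x + y \in H.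
  by move=> Hx Hy; rewrite -[y]opprK; apply: HB => //; exact: HN.
have HMn x n : x \in H -> x *+ n \in H.
  by move=> Hx; elim: n => [|n IH]; rewrite ?mulr0n // mulrS; exact: HD.
exists [set x | exists h t, h \in H /\ pi x = h + l%:R * pi t]; split.
- split; first by exists 0, 0; rewrite !rmorph0 mulr0 addr0.
  move=> x x' [h [t [Hh xE]]] [h' [t' [Hh' xE']]]; exists (h - h'), (t - t').
  by rewrite !rmorphB xE xE'; split; [exact: HB|ring].
- by move=> x [t xt]; exists 0, t; rewrite add0r.
- move=> GT; apply: HT; apply/setP => c; rewrite inE.
  (* Nakayama: [C = H + l C] substituted into itself gives [C = H + l ^ j C], and
     [l ^ (m + 1) = 0]. *)
  have gen j x : exists h t, h \in H /\ pi x = h + l%:R ^+ j * pi t.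
    elim: j => [|j [h [t [Hh ->]]]]; first by exists 0, x; rewrite add0r mul1r.
    have : [set x | exists h t, h \in H /\ pi x = h + l%:R * pi t] t by rewrite GT.
    move=> [h' [t' [Hh' ->]]]; exists (h + l%:R ^+ j * h'), t'; split.
      by apply: HD => //; rewrite -natrX mulr_natl; exact: HMn.
    by rewrite exprS; ring.
  have [x <-] := sur c; have [h [t [Hh ->]]] := gen m.+1 x.
  suff -> : l%:R ^+ m.+1 = 0 :> C by rewrite mul0r addr0.
  by rewrite -(rmorph_nat pi) -rmorphXn; apply/kpi; exact: ideal_pow_expr.
- by move=> x Hx; exists (pi x), 0; rewrite rmorph0 mulr0 addr0.
Qed.

End QuotientMaps.

(** * Left kernel vectors of random matrices *)

Section FiniteLaw.
Variables (R : realType) (d : measure_display) (Omega : measurableType d)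
  (P : probability Omega R).
Local Open Scope ereal_scope.

Definition prob (A : set Omega) : R := fine (P A).

Lemma probE (A : set Omega) : measurable A -> P A = (prob A)%:E.
Proof. by move=> mA; rewrite fineK // fin_num_measure. Qed.

Lemma prob_ge0 (A : set Omega) : (0 <= prob A)%R.
Proof. exact/fine_ge0/measure_ge0. Qed.

Variables (C : finType) (Y : Omega -> C).
Hypothesis mY : forall c, measurable [set w | Y w = c].

Lemma measurable_fin_event (S : pred C) : measurable [set w | S (Y w)].
Proof.
have -> : [set w | S (Y w)] = \bigcup_(c in [set c | S c]) [set w | Y w = c].
  by apply/seteqP; split=> [w Sw|w [c Sc /= ->]] //; exists (Y w).
by apply: fin_bigcup_measurable => // c _; exact: mY.
Qed.

Lemma prob_fin_event (S : pred C) :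
  prob [set w | S (Y w)] = (\sum_(c | S c) prob [set w | Y w = c])%R.
Proof.
have H (s : seq C) : uniq s -> P [set w | (Y w \in s) && S (Y w)] =
    (\sum_(c <- s | S c) prob [set w | Y w = c])%R%:E.
  elim: s => [_|c s IH /= /andP[cs us]].
    by rewrite big_nil -[RHS](measure0 P); congr (P _); apply/seteqP; split.
  have mS : measurable [set w | (Y w \in s) && S (Y w)].
    exact: (measurable_fin_event [pred c | (c \in s) && S c]).
  rewrite big_cons; case: ifPn => Sc.
    rewrite EFinD -probE // -IH // -measureU //.
      congr (P _); apply/seteqP; split => w /=.
        by rewrite inE andb_orl => /orP[/andP[/eqP]|]; [left|right].
      by rewrite inE => -[->|/andP[-> ->]]; rewrite ?eqxx ?orbT.
    by apply/seteqP; split=> // w /= [-> /andP[]]; rewrite (negPf cs).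
  rewrite -IH //; congr (P _); apply/seteqP; split => w /=.
    by rewrite inE andb_orl => /orP[/andP[/eqP ->]|] //; rewrite (negPf Sc).
  by rewrite inE => /andP[-> ->]; rewrite orbT.
apply: EFin_inj; rewrite -probE; last exact: measurable_fin_event.
rewrite -H ?index_enum_uniq //; congr (P _); apply/seteqP; split => w /=.
  by rewrite mem_index_enum.
by case/andP.
Qed.

End FiniteLaw.

Section RandomMatrix.
Variables (T : idomainType) (R : realType) (d : measure_display)
  (Omega : measurableType d) (P : probability Omega R) (eps : set T -> R)
  (n l : nat) (X : Omega -> 'M[T]_(n, l)).
Hypotheses (cT : countable_ring T) (bX : balanced_matrix P eps X).
Local Open Scope ereal_scope.

(** There are countably many matrices, and each event [X w = A] is a finite intersection of entry
    events; so even finiteness of the completed cokernel is an event. *)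
Lemma measurable_matrix_event (Q : 'M[T]_(n, l) -> Prop) :
  measurable [set w | Q (X w)].
Proof.
have [h hinj] := cT; have [disX _ _] := bX.
pose code (A : 'M[T]_(n, l)) : nat := choice.pickle (map_mx h A).
have code_inj : injective code.
  move=> A B /(pcan_inj choice.pickleK) /matrixP AB; apply/matrixP => i j.
  by have := AB i j; rewrite !mxE => /hinj.
have -> : [set w | Q (X w)] = \bigcup_k [set w | Q (X w) /\ code (X w) = k].
  by apply/seteqP; split=> [w Qw|w [k _ []]] //; exists (code (X w)).
apply: bigcupT_measurable => k.
have [[A [QA <-]]|noA] := pselect (exists A, Q A /\ code A = k); last first.
  have -> : [set w | Q (X w) /\ code (X w) = k] = set0 by
    apply/seteqP; split=> // w [Qw kw]; apply: noA; exists (X w).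
  exact: measurable0.
have -> : [set w | Q (X w) /\ code (X w) = code A] =
    \bigcap_(ij : 'I_n * 'I_l) [set w | X w ij.1 ij.2 = A ij.1 ij.2].
  apply/seteqP; split=> [w [_ /code_inj XA] ij _ /=|w XA]; first by rewrite XA.
  suff /= -> : X w = A by [].
  by apply/matrixP => i j; exact: (XA (i, j)).
apply: fin_bigcap_measurable => // ij _.
exact: (disX ij.1 ij.2 [set x | x = A ij.1 ij.2]).
Qed.

Variables (C : finComNzRingType) (pi : {rmorphism T -> C}).

Definition entry_law j i c : R := prob P [set w | pi (X w i j) = c].

Lemma measurable_entry i j c : measurable [set w | pi (X w i j) = c].
Proof. exact: (measurable_matrix_event (fun A => pi (A i j) = c)). Qed.

Lemma entry_law_weights j i : prob_weights (entry_law j i).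
Proof.
split=> [c|]; first exact: prob_ge0.
rewrite -(prob_fin_event P (measurable_entry i j) predT).
apply: EFin_inj; rewrite -probE; last exact: (measurable_matrix_event (fun=> true)).
by rewrite -[RHS](probability_setT P); congr (P _); apply/seteqP; split.
Qed.

Lemma entry_law_balanced (I : set T) j i : elem_abelian_quotient I ->
    (forall c, exists x, pi x = c) ->
    (forall H : {set C}, add_subgroup H -> H <> [set: C]%SET ->
      exists G : set T, [/\ G 0%R /\ (forall x x', G x -> G x' -> G (x - x')%R),
          I `<=` G, G <> setT & forall x, pi x \in H -> G x]) ->
  balanced (eps I) (entry_law j i).
Proof.
move=> eI sur HG H a sH HT; have [G [sG IG GT piG]] := HG H sH HT.
have [a' <-] := sur a; have [_ _ /(_ i j) bal] := bX.
rewrite -(prob_fin_event P (measurable_entry i j) (fun c => (c - pi a')%R \in H)).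
rewrite -lee_fin -probE; last first.
  exact: (measurable_matrix_event (fun A => (pi (A i j) - pi a')%R \in H)).
apply: le_trans (bal I eI G a' sG IG GT); apply: le_measure; rewrite ?inE.
- exact: (measurable_matrix_event (fun A => (pi (A i j) - pi a')%R \in H)).
- exact: (measurable_matrix_event (fun A => G (A i j - a')%R)).
- by move=> w /=; rewrite -rmorphB; exact: piG.
Qed.

(** Entrywise independence makes the point masses of the reduced matrix products over columns, so
    the [l] column conditions multiply. *)
Lemma kernel_vector_prob (f : 'I_n -> C) (B : R) :
    (forall j, (\sum_(c : {ffun 'I_n -> C} | \sum_i f i * c i == 0)
        \prod_i entry_law j i (c i) <= B)%R) ->
  P [set w | forall j, (\sum_i f i * pi (X w i j))%R = 0%R] <= (B ^+ l)%:E.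
Proof.
move=> le_B.
pose Z w : {ffun 'I_l -> {ffun 'I_n -> C}} := [ffun j => [ffun i => pi (X w i j)]].
pose S (z : {ffun 'I_l -> {ffun 'I_n -> C}}) :=
  z \in ffun_on [pred c : {ffun 'I_n -> C} | (\sum_i f i * c i == 0)%R].
have mZ z : measurable [set w | Z w = z].
  pose Z' (A : 'M[T]_(n, l)) : {ffun 'I_l -> {ffun 'I_n -> C}} :=
    [ffun j => [ffun i => pi (A i j)]].
  exact: (measurable_matrix_event (fun A => Z' A = z)).
have -> : [set w | forall j, (\sum_i f i * pi (X w i j))%R = 0%R] = [set w | S (Z w)].
  apply/seteqP; split=> w /= H.
    apply/ffun_onP => j; rewrite inE ffunE; apply/eqP; rewrite -[RHS](H j).
    by apply: eq_bigr => i _; rewrite ffunE.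
  move=> j; move/ffun_onP: H => /(_ j); rewrite inE ffunE => /eqP H.
  by rewrite -[RHS]H; apply: eq_bigr => i _; rewrite ffunE.
rewrite probE; last exact: (measurable_fin_event mZ S).
rewrite lee_fin
 (prob_fin_event P mZ S).
have [_ indep _] := bX.
have lawZ z : prob P [set w | Z w = z] = (\prod_j \prod_i entry_law j i (z j i))%R.
  rewrite /prob; have -> : [set w | Z w = z] =
      [set w | forall i j, [set x | pi x = z j i] (X w i j)].
    apply/seteqP; split=> [w /= <- i j|w /= H]; first by rewrite !ffunE.
    by apply/ffunP => j; apply/ffunP => i; rewrite !ffunE; exact: H.
  rewrite (indep (fun i j => [set x | pi x = z j i])).
  rewrite (_ : \big[_/_]_(i < n) _ = (\prod_i \prod_j entry_law j i (z j i))%R%:E).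
    by rewrite /= exchange_big.
  rewrite (big_morph EFin EFinM (erefl 1)); apply: eq_bigr => i _.
  rewrite (big_morph EFin EFinM (erefl 1)); apply: eq_bigr => j _.
  by rewrite -probE //; exact: measurable_entry.
rewrite (eq_bigr _ (fun z _ => lawZ z)).
rewrite -(bigA_distr_big _ (fun j (c : {ffun 'I_n -> C}) => \prod_i entry_law j i (c i))%R).
rewrite -[l in (B ^+ l)%R]card_ord -prodr_const; apply: ler_prod => j _.
rewrite (le_B j) andbT; apply: sumr_ge0 => c _; apply: prodr_ge0 => i _.
exact: prob_ge0.
Qed.

Lemma kernel_union_bound (S : pred {ffun 'I_n -> C}) (B : {ffun 'I_n -> C} -> R) :
    (forall f, S f -> forall j, (\sum_(c : {ffun 'I_n -> C} | \sum_i f i * c i == 0)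
        \prod_i entry_law j i (c i) <= B f)%R) ->
  P [set w | exists f, S f /\ forall j, (\sum_i f i * pi (X w i j))%R = 0%R]
    <= (\sum_(f | S f) B f ^+ l)%R%:E.
Proof.
move=> le_B.
pose K f := [set w | forall j, (\sum_i f i * pi (X w i j))%R = 0%R].
have mK (f : {ffun 'I_n -> C}) : measurable (K f).
  exact: (measurable_matrix_event (fun A => forall j, (\sum_i f i * pi (A i j))%R = 0%R)).
have -> : [set w | exists f, S f /\ forall j, (\sum_i f i * pi (X w i j))%R = 0%R]
    = \big[setU/set0]_(f | S f) K f.
  apply/seteqP; split=> w /=.
    by move=> [f [Sf Kf]]; rewrite (bigD1 f) //=; left.
  by elim/big_ind: _ => // [A B' hA hB [/hA|/hB]|f Sf Kf] //; exists f.
suff [] : measurable (\big[setU/set0]_(f | S f) K f) /\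
    P (\big[setU/set0]_(f | S f) K f) <= (\sum_(f | S f) B f ^+ l)%R%:E by [].
elim/big_rec2: _ => [|f b A Sf [mA PA]]; first by rewrite measure0.
split; first exact: measurableU.
apply: le_trans (measureU2 _ _ _) _ => //; rewrite EFinD leeD //.
by apply: kernel_vector_prob => j; exact: le_B.
Qed.


End RandomMatrix.

(** * Elementary inequalities and the count of sparse vectors *)

Section Estimates.
Variable R : realType.
Implicit Types (r eta tau theta : R).

Lemma expr_small r eta : 0 <= r < 1 -> 0 < eta ->
  exists n0, forall n, (n0 <= n)%N -> r ^+ n <= eta.
Proof.
move=> /andP[r0 r1] eta0.
have /cvg_expr/cvgr0Pnorm_le/(_ eta eta0)[n0 _ Hn0] : `|r| < 1 by rewrite ger0_norm.
exists n0 => n /Hn0 /=; rewrite ger0_norm //; exact: exprn_ge0.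
Qed.

Lemma bernoulli r n : 0 <= r -> 1 + n%:R * r <= (1 + r) ^+ n.
Proof.
move=> r0; elim: n => [|n IH]; first by rewrite mul0r addr0 expr0.
rewrite exprS; apply: le_trans (ler_wpM2l _ IH); last by rewrite addr_ge0.
have : 0 <= n%:R * r * r by rewrite !mulr_ge0.
by rewrite -natr1; lra.
Qed.

(** The inductive invariant is [(1 + a) ^ n * (1 - n a) <= 1]. *)
Lemma expr_le2 (a : R) n : 0 <= a -> n%:R * a <= 2^-1 -> (1 + a) ^+ n <= 2.
Proof.
move=> a0 na; suff : (1 + a) ^+ n * (1 - n%:R * a) <= 1.
  have : 0 <= (1 + a) ^+ n by rewrite exprn_ge0 // addr_ge0.
  move: ((1 + a) ^+ n) => z z0 h.
  have : z * 2^-1 <= z * (1 - n%:R * a) by rewrite ler_wpM2l //; lra.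
  lra.
elim: n {na} => [|n IH]; first by rewrite mul0r subr0 mulr1.
apply: le_trans IH; rewrite exprSr -mulrA ler_wpM2l ?exprn_ge0 ?addr_ge0 //.
have : 0 <= n%:R * a * a by rewrite !mulr_ge0.
rewrite -natr1; have : 0 <= a * a by rewrite mulr_ge0.
lra.
Qed.

(** Keeps the accumulated relative error over [K] columns bounded when [K] is linear in [b]. One
    factor [(1 - tau) ^ b] absorbs [b.+1] through Bernoulli, the other is made small. *)
Lemma expr1D_geometric_le2 (tau : R) (N c : nat) : 0 < tau <= 1 ->
  exists b0, forall b K, (b0 <= b)%N -> (K <= c * b.+1)%N ->
    (1 + N%:R * (1 - tau) ^+ (2 * b)) ^+ K <= 2.
Proof.
move=> /andP[tau0 tau1]; set r := 1 - tau.
have r01 : 0 <= r < 1 by rewrite /r; apply/andP; split; lra.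
have r0 : 0 <= r by case/andP: r01.
have eta0 : 0 < tau / (2 * (c * N).+1%:R) by rewrite divr_gt0 // mulr_gt0 // ltr0n.
have [b0 Hb0] := expr_small r01 eta0; exists b0 => b K /Hb0 rb Kb.
apply: expr_le2; first by rewrite mulr_ge0 ?exprn_ge0.
have bern : b.+1%:R * tau * r ^+ b <= 1.
  have h1 : b.+1%:R * tau <= 1 + b%:R * tau by rewrite -natr1; lra.
  have h2 : (1 + tau) ^+ b * r ^+ b <= 1.
    rewrite -exprMn exprn_ile1 //.
      by rewrite mulr_ge0 // addr_ge0 // ltW.
    by rewrite /r; have := sqr_ge0 tau; lra.
  apply: le_trans h2; rewrite ler_wpM2r ?exprn_ge0 //.
  by apply: le_trans h1 _; apply: bernoulli; exact: ltW.
have Kc : K%:R <= c%:R * b.+1%:R :> R by rewrite -natrM ler_nat.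
have rb0 : 0 <= r ^+ b by rewrite exprn_ge0.
apply: (@le_trans _ _ (c%:R * b.+1%:R * (N%:R * r ^+ (2 * b)))).
  by rewrite ler_wpM2r // mulr_ge0 ?exprn_ge0.
rewrite mul2n -addnn exprD.
have -> : c%:R * b.+1%:R * (N%:R * (r ^+ b * r ^+ b)) =
    (b.+1%:R * tau * r ^+ b) * ((c * N)%:R * r ^+ b / tau).
  by rewrite natrM; field; lra.
apply: (@le_trans _ _ (1 * ((c * N)%:R * r ^+ b / tau))).
  by apply: ler_wpM2r => //; rewrite divr_ge0 ?mulr_ge0 // ltW.
rewrite mul1r ler_pdivrMr //.
apply: (@le_trans _ _ ((c * N).+1%:R * r ^+ b)); first by rewrite ler_wpM2r // ler_nat.
have : (c * N).+1%:R * r ^+ b <= (c * N).+1%:R * (tau / (2 * (c * N).+1%:R)).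
  by rewrite ler_wpM2l.
have -> : (c * N).+1%:R * (tau / (2 * (c * N).+1%:R)) = 2^-1 * tau; last by [].
have : (c * N).+1%:R != 0 :> R by rewrite pnatr_eq0.
by move: (_.+1%:R) => z zN0; field.
Qed.

(* Markov's inequality for [theta ^+ weight]. *)
Lemma sparse_count (C : finNmodType) n b theta : 0 < theta <= 1 ->
  \sum_(f : {ffun 'I_n -> C} | (#|[pred i | f i != 0%R]| <= b)%N) 1
    <= theta ^- b * (1 + #|C|%:R * theta) ^+ n.
Proof.
move=> /andP[t0 t1].
pose F (i : 'I_n) (c : C) := if c != 0 then theta else 1.
have F0 i c : 0 <= F i c by rewrite /F; case: ifP => _ //; exact: ltW.
apply: (@le_trans _ _ (\sum_(f : {ffun 'I_n -> C}) theta ^- b * \prod_i F i (f i))).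
  rewrite big_mkcond; apply: ler_sum => f _.
  have pos : 0 <= theta ^- b * \prod_i F i (f i).
    apply: mulr_ge0; last by apply: prodr_ge0 => i _; exact: F0.
    by rewrite invr_ge0; apply/exprn_ge0/ltW.
  case: ifP => // wb; rewrite /F -big_mkcond prodr_const.
  rewrite mulrC ler_pdivlMr ?exprn_gt0 // mul1r.
  by apply: ler_wiXn2l => //; exact: ltW.
rewrite -mulr_sumr ler_wpM2l //; first by rewrite invr_ge0; apply/exprn_ge0/ltW.
rewrite -bigA_distr_bigA -[n in X in _ <= X]card_ord -prodr_const.
apply: ler_prod => i _; rewrite sumr_ge0 //= (bigD1 0) //= {1}/F eqxx lerD2l.
rewrite (eq_bigr (fun=> theta)) => [|c c0]; last by rewrite /F c0.
rewrite sumr_const -[theta *+ _]mulr_natl; apply: ler_wpM2r; first exact: ltW.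
rewrite ler_nat.

exact: max_card.
Qed.

End Estimates.

(** * Sparse and dense kernel vectors of the reduced matrix *)

Section RandomKernel.
Variables (T : idomainType) (R : realType) (d : measure_display)
  (Omega : measurableType d) (P : probability Omega R) (eps : set T -> R)
  (n l : nat) (X : Omega -> 'M[T]_(n, l)).
Hypotheses (cT : countable_ring T) (bX : balanced_matrix P eps X).
Variables (C : finComNzRingType) (pi : {rmorphism T -> C}) (e : R).
Hypotheses (e01 : 0 < e <= 1)
  (bal : forall j i, balanced e (entry_law P X pi j i)).

(** Counting with [theta = e / #|C|] costs [(1 + e) ^ n], which against [(1 - e) ^ l] leaves
    [(1 - e ^ 2) ^ n]. *)
Lemma sparse_kernel_prob b : (n <= l)%N ->
    (forall c : C, c != 0 -> injective ( *%R c)) ->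
  (P [set w | exists f : {ffun 'I_n -> C},
      (0 < #|[pred i | f i != 0%R]| <= b)%N /\
      forall j, (\sum_i f i * pi (X w i j) = 0)%R]
    <= ((#|C|%:R / e) ^+ b * (1 - e ^+ 2) ^+ n)%:E)%E.
Proof.
move=> nl inj; have /andP[e0 e1] := e01.
pose S := [pred f : {ffun 'I_n -> C} | (0 < #|[pred i | f i != 0%R]| <= b)%N].
have le_B f : S f -> forall j, \sum_(c : {ffun 'I_n -> C} | \sum_i f i * c i == 0)
    \prod_i entry_law P X pi j i (c i) <= 1 - e.
  move=> /andP[/card_gt0P[i fi] _] j; apply: walk_atom_bound => //.
  - exact: ltW.
  - by move=> i'; exact: (entry_law_weights cT bX).
  - by move=> i'; exact: inj.
  - by exists i.
apply: le_trans (kernel_union_bound cT bX (B := fun=> 1 - e) le_B) _.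
rewrite lee_fin; have C0 : 0 < #|C|%:R :> R by rewrite ltr0n; apply/card_gt0P; exists 0.
have C1 : 1 <= #|C|%:R :> R by rewrite ler1n; apply/card_gt0P; exists 0.
have th : 0 < e / #|C|%:R <= 1.
  by rewrite divr_gt0 //= ler_pdivrMr // mul1r (le_trans e1).
apply: (@le_trans _ _ ((1 - e) ^+ l * ((e / #|C|%:R) ^- b * (1 + #|C|%:R * (e / #|C|%:R)) ^+ n))).
  apply: le_trans (ler_wpM2l _ (sparse_count C n b th)); last by rewrite exprn_ge0 // subr_ge0.
  rewrite mulr_sumr big_mkcond [X in _ <= X]big_mkcond; apply: ler_sum => f _.
  rewrite /S /= mulr1; case: ifP => [/andP[_ ->] //|_]; case: ifP => _ //.
  by rewrite exprn_ge0 // subr_ge0.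
have -> : #|C|%:R * (e / #|C|%:R) = e by field; lra.
have -> : 1 - e ^+ 2 = (1 - e) * (1 + e) by ring.
rewrite [((1 - e) * _) ^+ _]exprMn mulrCA -exprVn invf_div; apply: ler_wpM2l.
  by rewrite exprn_ge0 // divr_ge0 // ltW.
apply: ler_wpM2r; first by rewrite exprn_ge0 // addr_ge0 // ltW.
by apply: ler_wiXn2l => //; lra.
Qed.

(** All [#|C| ^ n] vectors may be counted, since with [l = n + u] each has probability near
    [#|C| ^- (n + u)]. *)
Lemma dense_kernel_prob b :
  (P [set w | exists f : {ffun 'I_n -> C},
      (b <= #|[pred i | injectiveb ( *%R (f i))]|)%N /\
      forall j, (\sum_i f i * pi (X w i j) = 0)%R]
    <= ((#|C| ^ n)%:R * (#|C|%:R^-1 + (1 - e / (8 * 4 ^+ #|C|)) ^+ (2 * b)) ^+ l)%:E)%E.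
Proof.
have /andP[e0 e1] := e01.
pose S := [pred f : {ffun 'I_n -> C} | (b <= #|[pred i | injectiveb ( *%R (f i))]|)%N].
set B := _ + _ ^+ _.
have four1 : 1 <= 4 ^+ #|C| :> R by rewrite exprn_ege1 // ler1n.
have r01 : 0 <= 1 - e / (8 * 4 ^+ #|C|) <= 1.
  by rewrite subr_ge0 ler_pdivrMr ?gerBl ?divr_ge0 //; lra.
have /andP[r0 r1] := r01.
have B0 : 0 <= B by rewrite addr_ge0 ?invr_ge0 ?exprn_ge0.
have le_B f : S f -> forall j, \sum_(c : {ffun 'I_n -> C} | \sum_i f i * c i == 0)
    \prod_i entry_law P X pi j i (c i) <= B.
  move=> Sf j.
  apply: (@le_trans _ _ (#|C|%:R^-1 + (1 - e / (8 * 4 ^+ #|C|)) ^+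
      (2 * #|[pred i | injectiveb ( *%R (f i))]|))).
    apply: walk_return_bound.
    - by rewrite e1 ltW.
    - by move=> i; exact: (entry_law_weights cT bX).
    - by move=> i; exact: bal.
    - by move=> i /injectiveP.
  by rewrite lerD2l ler_wiXn2l // leq_mul2l.
apply: le_trans (kernel_union_bound cT bX (B := fun=> B) le_B) _.
rewrite lee_fin sumr_const -[_ *+ _]mulr_natl; apply: ler_wpM2r; first exact: exprn_ge0.
rewrite ler_nat; apply: leq_trans (max_card _) _.
by rewrite card_ffun card_ord.
Qed.

End RandomKernel.

(** * Choice of parameters and conclusion *)

Lemma balanced_le (R : realFieldType) (C : finComNzRingType) (e e' : R) (mu : C -> R) :
  e <= e' -> balanced e' mu -> balanced e mu.
Proof. by move=> ee' bmu H a sH HT; apply: le_trans (bmu H a sH HT) _; lra. Qed.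


(** The order of quantifiers matters: [C], [pi] and [e] are fixed before the size and law of the
    matrix. *)
Lemma prime_power_quotient_balanced (T : idomainType) (p : set T) m (R : realType)
    (eps : set T -> R) :
    dedekind T -> finite_residues T -> prime_ideal p -> nonzero_ideal p ->
    countable_ring T -> (forall I, elem_abelian_quotient I -> 0 < eps I) ->
  exists (C : finComNzRingType) (pi : {rmorphism T -> C}) (e : R),
  [/\ quotient_map (ideal_pow p m.+1) pi, (m < #|C|)%N,
      (forall x, ~ p x -> injective ( *%R (pi x))), 0 < e <= 1 &
      forall (d : measure_display) (Omega : measurableType d) (P : probability Omega R)
        n l (X : Omega -> 'M[T]_(n, l)), balanced_matrix P eps X ->
      forall j i, balanced e (entry_law P X pi j i)].
Proof.
move=> dT fT pp nzp cT eps0.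
have [C [pi [qpi mC inj [I eI HG]]]] := prime_power_quotient m dT fT pp nzp.
exists C, pi, (Num.min (eps I) 1); split=> //.
  by rewrite lt_min eps0 //= ltr01 ge_min lexx orbT.
move=> d Omega P n l X bX j i; apply: (@balanced_le _ _ _ (eps I)).
  by rewrite ge_min lexx.
have [sur _] := qpi; exact: (entry_law_balanced cT bX _ _ eI sur HG).
Qed.

Lemma infinite_cok_small (T : idomainType) (R : realType) (eps : set T -> R)
    (k : nat) (ps : 'I_k -> set T) (u : nat)
    (d : measure_display) (Omega : measurableType d) (P : probability Omega R)
    (M : forall n : nat, Omega -> 'M[T]_(n, n + u)) :
    dedekind T -> countable_ring T -> finite_residues T ->
    (forall I, elem_abelian_quotient I -> 0 < eps I) ->
    (forall i, prime_ideal (ps i) /\ nonzero_ideal (ps i)) -> (0 < k)%N -> (0 < u)%N ->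
    (forall n, balanced_matrix P eps (M n)) ->
  forall eta : R, 0 < eta -> exists n0, forall n, (n0 <= n)%N ->
    (P [set w | ~ cok_tensor_finite ps (M n w)] <= eta%:E)%E.
Proof.
move=> dT cT fT eps0 Hps k0 u0 bM eta eta0.
pose p := ps (Ordinal k0); have [pp nzp] : prime_ideal p /\ nonzero_ideal p by exact: Hps.
have [ip _ _] := pp; have [_ _ maxT] := dT.
have [C0 [pi0 [e0 [[sur0 ker0] _ inj0 e01 bal0]]]] :=
  prime_power_quotient_balanced 0 dT fT pp nzp cT eps0.
rewrite ideal_pow1 // in ker0.
have /andP[e0_gt0 e0_le1] := e01.
have C0gt : 0 < #|C0|%:R :> R by rewrite ltr0n; apply/card_gt0P; exists 0.
have half : 0 <= (2^-1 : R) < 1 by rewrite invr_ge0 ler0n invf_lt1 ?ltr0n // ltr1n.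
have s01 : 0 <= 1 - e0 ^+ 2 < 1.
  have : 0 < e0 ^+ 2 by rewrite exprn_gt0.
  have : e0 ^+ 2 <= 1 by rewrite exprn_ile1 // ltW.
  by move=> *; apply/andP; split; lra.
have th0 : 0 < e0 / (2 * #|C0|%:R) by rewrite divr_gt0 // mulr_gt0.
(* Then [2 * #|C0| / e0 * (1 - e0 ^ 2) ^ h <= 1], so that [h * b <= n] makes the sparse bound at
   most [2 ^- b]. *)
have [h0 Hh] := expr_small s01 th0; pose h := h0.+1.
have [b1 Hb1] := expr_small half (divr_gt0 eta0 (ltr0Sn R 1)).
(* As [m < #|C|], this gives [2 / #|C| <= eta / 2] for the dense bound. *)
have [m m_eta] : exists m : nat, 4 / eta <= m%:R.
  by exists (Num.trunc (4 / eta)).+1; apply/ltW/truncnS_gt.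
have [C [pi [e [qpi mC inj e01' bal]]]] :=
  prime_power_quotient_balanced m dT fT pp nzp cT eps0.
have Cgt : 0 < #|C|%:R :> R by rewrite ltr0n; apply/card_gt0P; exists 0.
have tau01 : 0 < e / (8 * 4 ^+ #|C|) <= 1.
  have /andP[e_gt0 e_le1] := e01'.
  have four1 : 1 <= 4 ^+ #|C| :> R by rewrite exprn_ege1 // ler1n.
  by rewrite divr_gt0 ?mulr_gt0 ?exprn_gt0 //= ler_pdivrMr; lra.
(* The factor [h + u] is there because [n + u <= (h + u) * b.+1] for [b = n %/ h]. *)
have [b2 Hb2] := expr1D_geometric_le2 #|C| (h + u) tau01.
exists (h * maxn b1 b2)%N => n hn; pose b := (n %/ h)%N.
have /andP[b1b b2b] : (b1 <= b)%N && (b2 <= b)%N.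
  by rewrite -geq_max leq_divRL // mulnC.
have hbn : (h * b <= n)%N by rewrite mulnC leq_trunc_div.
pose A1 (X : 'M[T]_(n, n + u)) := exists f : {ffun 'I_n -> C0},
  (0 < #|[pred i | f i != 0%R]| <= b)%N /\ forall j, \sum_i f i * pi0 (X i j) = 0.
pose A2 (X : 'M[T]_(n, n + u)) := exists f : {ffun 'I_n -> C},
  (b <= #|[pred i | injectiveb ( *%R (f i))]|)%N /\ forall j, \sum_i f i * pi (X i j) = 0.
have mA (Q : 'M[T]_(n, n + u) -> Prop) : measurable [set w | Q (M n w)].
  exact: measurable_matrix_event cT (bM n) Q.
have sub : [set w | ~ cok_tensor_finite ps (M n w)] `<=`
    [set w | A1 (M n w)] `|` [set w | A2 (M n w)].
  move=> w /= ncok.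
  have [x xM x0] : exists2 x : 'rV_n, x *m M n w = 0 & x != 0.
    apply: contrapT => H; apply: ncok; apply: cok_tensor_finite_of_trivial_kernel => //.
      by move=> i; have [[]] := Hps i.
    by move=> x xM; apply/eqP; apply: contrapT => /negP x0; apply: H; exists x.
  have [y yM [i0 py0]] := primitive_kernel_vector dT pp nzp x0 xM.
  have ker (D : finComNzRingType) (rho : {rmorphism T -> D}) j :
      \sum_i [ffun i => rho (y 0 i)] i * rho (M n w i j) = 0.
    have /matrixP/(_ 0 j) := yM; rewrite !mxE => /(congr1 rho); rewrite rmorph0 rmorph_sum => E0.
    by rewrite -[RHS]E0; apply: eq_bigr => i _; rewrite ffunE rmorphM.
  pose f0 := [ffun i => pi0 (y 0 i)] : {ffun 'I_n -> C0}.
  have f0P a : f0 a != 0 <-> ~ p (y 0 a).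
    by rewrite ffunE -ker0; split=> [/eqP//|h1]; exact/eqP.
  (* The same [y] serves both cases: a coordinate is nonzero in [C0] exactly when it is outside [p],
     and it then acts injectively on [C]. *)
  have [wb|wb] := leqP #|[pred i | f0 i != 0]| b.
    left; exists f0; split; last exact: ker.
    by rewrite wb andbT; apply/card_gt0P; exists i0; apply/f0P.
  right; exists [ffun i => pi (y 0 i)]; split; last exact: ker.

  apply: leq_trans (ltnW wb) _; apply: subset_leq_card; apply/fintype.subsetP => i.
  rewrite inE => /f0P/inj injy; rewrite inE /= ffunE; exact/injectiveP.
have P1 : (P [set w | A1 (M n w)] <= (eta / 2)%:E)%E.
  apply: le_trans (sparse_kernel_prob cT (bM n) e01 (bal0 _ _ _ _ _ _ (bM n)) b _ _) _.
  - exact: leq_addr.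
  - move=> c c0; have [x xc] := sur0 c; rewrite -xc; apply: inj0 => /ker0 x0.
    by rewrite -xc x0 eqxx in c0.
  rewrite lee_fin; apply: le_trans (Hb1 b b1b).
  rewrite exprVn -[X in _ <= X]div1r ler_pdivlMr ?exprn_gt0 // mulrAC -exprMn.
  apply: (@le_trans _ _ ((#|C0|%:R / e0 * 2) ^+ b * ((1 - e0 ^+ 2) ^+ h) ^+ b)).
    apply: ler_wpM2l; first by rewrite exprn_ge0 // mulr_ge0 // divr_ge0 // ltW.
    by rewrite -exprM; apply: ler_wiXn2l => //; case/andP: s01 => // _ /ltW.
  rewrite -exprMn exprn_ile1 //.
    apply: mulr_ge0; last by apply: exprn_ge0; case/andP: s01.
    by apply: mulr_ge0 => //; apply: divr_ge0; exact: ltW.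
  have := Hh h (leqnSn h0); rewrite ler_pdivlMr ?mulr_gt0 //.
  have -> : #|C0|%:R / e0 * 2 * (1 - e0 ^+ 2) ^+ h = (1 - e0 ^+ 2) ^+ h * (2 * #|C0|%:R) / e0.
    by field; lra.
  by rewrite ler_pdivrMr // mul1r.
have P2 : (P [set w | A2 (M n w)] <= (eta / 2)%:E)%E.
  apply: le_trans (dense_kernel_prob cT (bM n) e01' (bal _ _ _ _ _ _ (bM n)) b) _.
  rewrite lee_fin; set r := 1 - _.
  have E1 : #|C|%:R^-1 + r ^+ (2 * b) = #|C|%:R^-1 * (1 + #|C|%:R * r ^+ (2 * b)) :> R.
    by field; lra.
  rewrite E1 exprMn natrX mulrA.
  apply: (@le_trans _ _ (#|C|%:R^-1 * 2)).
    apply: ler_pM.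
    - by rewrite mulr_ge0 ?exprn_ge0 ?invr_ge0.
    - rewrite exprn_ge0 // addr_ge0 // mulr_ge0 // exprn_ge0 // /r.
      by case/andP: tau01 => _; rewrite subr_ge0.
    - rewrite exprD mulrA -exprMn divff ?gt_eqF // expr1n mul1r -[X in _ <= X]expr1.
      by apply: ler_wiXn2l; rewrite ?invr_ge0 ?invf_le1 // ler1n; apply/card_gt0P; exists 0.
    - apply: Hb2 => //; rewrite mulnDl mulnS leq_add //.
        by rewrite -mulnS ltnW // mulnC ltn_ceil.
      by rewrite leq_pmulr.
  rewrite mulrC ler_pdivrMr //.
  have h1 : 4 / eta <= #|C|%:R by apply: le_trans m_eta _; rewrite ler_nat ltnW.
  have : 4 <= #|C|%:R * eta by rewrite -ler_pdivrMr.
  lra.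
apply: (@le_trans _ _ (P ([set w | A1 (M n w)] `|` [set w | A2 (M n w)]))).
  apply: le_measure; rewrite ?inE //; first exact: (mA (fun A => ~ cok_tensor_finite ps A)).
  by apply: measurableU; [exact: (mA A1)|exact: (mA A2)].
apply: le_trans (measureU2 _ (mA A1) (mA A2)) _.
have -> : eta%:E
 = ((eta / 2)%:E + (eta / 2)%:E)%E by rewrite -EFinD -splitr.
exact: leeD.
Qed.

Theorem theorem3p3 (T : idomainType)
  (HT : dedekind T) (Hcount : countable_ring T) (Hfin : finite_residues T)
  (R : realType) (eps : set T -> R)
  (Heps : forall I, elem_abelian_quotient I -> 0 < eps I)
  (k : nat) (ps : 'I_k -> set T)
  (Hps : forall i, prime_ideal (ps i) /\ nonzero_ideal (ps i))
  (Hinj : injective ps)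
  (u : nat) (Hu : (0 < u)%N)
  (d : measure_display) (Omega : measurableType d) (P : probability Omega R)
  (M : forall n : nat, Omega -> 'M[T]_(n, n + u))
  (HM : forall n, balanced_matrix P eps (M n)) :
  (fun n => P [set w | cok_tensor_finite ps (M n w)]) @ \oo --> 1%E.
Proof.
have mF n : measurable [set w | cok_tensor_finite ps (M n w)].
  exact: measurable_matrix_event Hcount (HM n) _.
have PF n : P [set w | cok_tensor_finite ps (M n w)] \is a fin_num by exact: fin_num_measure.
(* With no primes the completed ring is zero and finiteness is automatic; otherwise there is a prime
   to work at. *)
have [k0|k0] := posnP k.
  rewrite (_ : (fun n => _) = cst 1%E); first exact: cvg_cst.
  have absurd (i : 'I_k) : False by case: i => i; rewrite k0.
  apply/funext => n /=; rewrite -[RHS](probability_setT P); congr (P _).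
  apply/seteqP; split=> // w _; exists 1%N, (fun _ _ _ _ => 0); split.
    by move=> _ i; case: (absurd i).
  by move=> v _; exists ord0, (fun _ _ _ => 0); split=> i; case: (absurd i).

apply: cvg_EFin; first by near=> n; exact: PF.
apply/cvgrPdist_le => eta eta0.
have [n0 Hn0] := infinite_cok_small HT Hcount Hfin Heps Hps k0 Hu HM eta0.
exists n0 => // n /= /Hn0.
rewrite (_ : [set w | ~ _] = ~` [set w | cok_tensor_finite ps (M n w)]) //.
rewrite probability_setC // -[P _]fineK // -EFinB lee_fin => le_eta.
rewrite ger0_norm // subr_ge0 -lee_fin fineK //; exact: probability_le1.
Unshelve. all: by end_near. Qed.
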